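(* Let $n\ge1$. The operators $D_s$ and $D_t$ commute with all of the following operators on $\mathcal{P}(\mathbb{R}^{2n},\mathbb{C})\otimes\mathbb{S}^\infty$, which realise the Lie algebra $\mathfrak{u}(n)$ (so $D_s$ and $D_t$ are $\mathfrak{u}(n)$-invariant): $$A_{jk}=y_j\partial_{x_k}-x_k\partial_{y_j}+y_k\partial_{x_j}-x_j\partial_{y_k}+i(q_jq_k-\partial_{q_j}\partial_{q_k})\quad(1\le j<k\le n),$$ $$B_{jj}=y_j\partial_{x_j}-x_j\partial_{y_j}+\tfrac i2(q_j^2-\partial_{q_j}^2)\quad(1\le j\le n),$$ $$C_{jk}=x_j\partial_{x_k}-x_k\partial_{x_j}+y_j\partial_{y_k}-y_k\partial_{y_j}+q_j\partial_{q_k}-q_k\partial_{q_j}\quad(1\le j<k\le n).$$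
   Context: $\mathbb{R}^{2n}$ has coordinates $(x_1,\dots,x_n,y_1,\dots,y_n)$; $\mathbb{S}^\infty=\mathcal{S}(\mathbb{R}^n,\mathbb{C})$ is the Schwartz space in variables $q_1,\dots,q_n$, and $\mathcal{P}(\mathbb{R}^{2n},\mathbb{C})$ is the space of complex polynomials on $\mathbb{R}^{2n}$. The symplectic Dirac operator and its twisted version are $$D_s=\sum_{j=1}^n(iq_j\partial_{y_j}-\partial_{q_j}\partial_{x_j}),\qquad D_t=\sum_{j=1}^n(iq_j\partial_{x_j}+\partial_{y_j}\partial_{q_j}).$$ *)

(* Defs.v *)
From HB Require Import structures.
From mathcomp Require Import all_boot all_order all_algebra.
From mathcomp Require Import complex.
From mathcomp.multinomials Require mpoly.
(* The notations of mpoly clash with those of the analysis library. *)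
Import (canonicals, coercions) mpoly.
From mathcomp Require Import all_classical all_reals all_analysis.
Import Order.TTheory GRing.Theory Num.Theory numFieldNormedType.Exports.

Set Implicit Arguments.
Unset Strict Implicit.
Unset Printing Implicit Defensive.

Local Open Scope classical_set_scope.
Local Open Scope ring_scope.
Local Open Scope complex_scope.

(** For subspaces [P] of [X -> K] and [S] of [Y -> K], the algebraic tensor
    product is realised inside [X -> Y -> K], with
    [p (x) f := fun x y => p x * f y].  [tensor_universal] shows that this has
    the universal property of the tensor product. *)

Definition tensor (K : fieldType) (X Y : Type)
    (P : set (X -> K)) (S : set (Y -> K)) : set (X -> Y -> K) :=
  [set F | exists (m : nat) (p : 'I_m -> X -> K) (f : 'I_m -> Y -> K),
     [/\ forall k, P (p k), forall k, S (f k)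
       & F = fun x y => \sum_(k < m) p k x * f k y]].

Definition is_subspace (K : fieldType) (X : Type) (P : set (X -> K)) : Prop :=
  P (fun=> 0) /\
  forall (a : K) p p', P p -> P p' -> P (fun x => a * p x + p' x).

Definition bilinear_on (K : fieldType) (X Y : Type) (W : lmodType K)
    (P : set (X -> K)) (S : set (Y -> K)) (b : (X -> K) -> (Y -> K) -> W) :=
  (forall a p p' f, P p -> P p' -> S f ->
     b (fun x => a * p x + p' x) f = a *: b p f + b p' f) /\
  (forall a p f f', P p -> S f -> S f' ->
     b p (fun y => a * f y + f' y) = a *: b p f + b p f').

Definition induced_by (K : fieldType) (X Y : Type) (W : lmodType K)
    (P : set (X -> K)) (S : set (Y -> K)) (b : (X -> K) -> (Y -> K) -> W)
    (phi : (X -> Y -> K) -> W) : Prop :=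
  (forall p f, P p -> S f -> phi (fun x y => p x * f y) = b p f) /\
  (forall a F G, tensor P S F -> tensor P S G ->
     phi (fun x y => a * F x y + G x y) = a *: phi F + phi G).

Section TensorUniversal.
Variables (K : fieldType) (X Y : Type) (W : lmodType K).
Variables (P : set (X -> K)) (S : set (Y -> K)).
Variable b : (X -> K) -> (Y -> K) -> W.
Hypotheses (subP : is_subspace P) (subS : is_subspace S).
Hypothesis bilin : bilinear_on P S b.

Let rep (F : X -> Y -> K) (w : W) : Prop :=
  exists (m : nat) (p : 'I_m -> X -> K) (f : 'I_m -> Y -> K),
    [/\ forall k, P (p k), forall k, S (f k),
        forall x y, F x y = \sum_(k < m) p k x * f k y
      & w = \sum_(k < m) b (p k) (f k)].

Let b0l f : S f -> b (fun=> 0) f = 0.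
Proof.
move=> Sf; have [P0 _] := subP; have := bilin.1 1 _ _ _ P0 P0 Sf.
rewrite scale1r (_ : (fun _ => _) = (fun=> 0)); last first.
  by apply/funext => x; rewrite mulr0 addr0.
by rewrite -{1}[b _ f]addr0 => /addrI.
Qed.

Let b0r p : P p -> b p (fun=> 0) = 0.
Proof.
move=> Pp; have [S0 _] := subS; have := bilin.2 1 _ _ _ Pp S0 S0.
rewrite scale1r (_ : (fun _ => _) = (fun=> 0)); last first.
  by apply/funext => x; rewrite mulr0 addr0.
by rewrite -{1}[b p _]addr0 => /addrI.
Qed.

Let b_sumr p m (d : 'I_m -> K) (f : 'I_m -> Y -> K) :
    P p -> (forall k, S (f k)) ->
  S (fun y => \sum_(k < m) d k * f k y) /\
  b p (fun y => \sum_(k < m) d k * f k y) = \sum_(k < m) d k *: b p (f k).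
Proof.
move=> Pp; elim: m d f => [|m IH] d f Sf.
  rewrite big_ord0 (_ : (fun _ => _) = (fun=> 0)).
    by split; [exact: subS.1|exact: b0r].
  by apply/funext => y; rewrite big_ord0.
have [S1 b1] := IH (d \o lift ord0) (f \o lift ord0) (fun k => Sf _).
rewrite big_ord_recl -b1 -(bilin.2 _ _ _ _ Pp (Sf ord0) S1).
rewrite (_ : (fun y => \sum_(k < m.+1) _) =
  (fun y => d ord0 * f ord0 y +
    \sum_(k < m) (d \o lift ord0) k * (f \o lift ord0) k y)).
  by split => //; apply: subS.2.
by apply/funext => y; rewrite big_ord_recl.
Qed.

Let rep0 m (p : 'I_m -> X -> K) (f : 'I_m -> Y -> K) :
    (forall k, P (p k)) -> (forall k, S (f k)) ->
    (forall x y, \sum_(k < m) p k x * f k y = 0) ->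
  \sum_(k < m) b (p k) (f k) = 0.
Proof.
elim: m p f => [|m IH] p f Pp Sf pf0; first by rewrite big_ord0.
have [p00|/existsNP[x0 /eqP c0]] := pselect (forall x, p ord0 x = 0).
  rewrite big_ord_recl (_ : p ord0 = fun=> 0); last exact/funext.
  rewrite b0l // add0r; apply: IH => // x y.
  by rewrite -[RHS](pf0 x y) big_ord_recl p00 mul0r add0r.
set c := p ord0 x0 in c0.
pose d k := - (p (lift ord0 k) x0 / c).
have f0E : f ord0 = fun y => \sum_(k < m) d k * f (lift ord0 k) y.
  apply/funext => y; apply: (mulfI c0).
  have /eqP := pf0 x0 y; rewrite big_ord_recl -/c addr_eq0 => /eqP ->.
  rewrite mulr_sumr -sumrN; apply: eq_bigr => k _.
  by rewrite /d mulrA mulrN mulrCA divff // mulr1 mulNr.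
have [_ bE] := b_sumr d (Pp ord0) (fun k => Sf (lift ord0 k)).
rewrite big_ord_recl f0E bE -big_split /=.
rewrite (eq_bigr (fun k => b (fun x => d k * p ord0 x + p (lift ord0 k) x)
                             (f (lift ord0 k)))); last first.
  by move=> k _; rewrite (bilin.1 _ _ _ _ (Pp _) (Pp _) (Sf _)).
apply: IH => [k|//|x y]; first exact: subP.2.
rewrite -[RHS](pf0 x y) big_ord_recl f0E mulr_sumr -big_split /=.
by apply: eq_bigr => k _; rewrite mulrDl mulrA [p ord0 x * _]mulrC.
Qed.

Let rep_lin a F G w v : rep F w -> rep G v ->
  rep (fun x y => a * F x y + G x y) (a *: w + v).
Proof.
move=> [m [p [f [Pp Sf FE ->]]]] [m' [p' [f' [Pp' Sf' GE ->]]]].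
have Pa k : P (fun x => a * p k x + 0) by apply: subP.2 => //; exact: subP.1.
exists (m + m')%N,
  (fun k : 'I_(m + m') => match fintype.split k with
            | inl i => fun x => a * p i x + 0 | inr j => p' j end),
  (fun k : 'I_(m + m') => match fintype.split k with inl i => f i | inr j => f' j end).
have spl i : fintype.split (lshift m' i) = inl i := unsplitK (inl i).
have spr j : fintype.split (rshift m j) = inr j := unsplitK (inr j).
split=> [k|k|x y|]; [by case: fintype.split|by case: fintype.split| |].
- rewrite FE GE big_split_ord mulr_sumr; congr (_ + _); apply: eq_bigr => k _.
    by rewrite spl addr0 mulrA.
  by rewrite spr.
- rewrite big_split_ord scaler_sumr; congr (_ + _); apply: eq_bigr => k _.
    by rewrite spl (bilin.1 _ _ _ _ (Pp _) subP.1 (Sf _)) b0l // addr0.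
  by rewrite spr.
Qed.

Let rep_uniq F w v : rep F w -> rep F v -> w = v.
Proof.
move=> Fw Fv; have [m [p [f [Pp Sf E wE]]]] := rep_lin (-1) Fw Fv.
apply/esym/eqP; rewrite -subr_eq0 addrC -scaleN1r wE; apply/eqP/rep0 => // x y.
by rewrite -E mulN1r addNr.
Qed.

Lemma tensor_universal :
  exists2 phi : (X -> Y -> K) -> W, induced_by P S b phi &
    forall psi, induced_by P S b psi ->
      forall F, tensor P S F -> psi F = phi F.
Proof.
have repT F : tensor P S F -> exists w, rep F w.
  by move=> [m [p [f [Pp Sf ->]]]]; exists (\sum_(k < m) b (p k) (f k)), m, p, f.
have rep1 p f : P p -> S f -> rep (fun x y => p x * f y) (b p f).
  move=> Pp Sf; exists 1%N, (fun=> p), (fun=> f).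
  by split=> // [x y|]; rewrite big_ord1.
pose phi F := xget 0 [set w | rep F w].
have phiE F w : rep F w -> phi F = w.
  by move=> Fw; rewrite /phi; case: xgetP => [v _ /= /rep_uniq|/(_ w)]; [exact|].
exists phi.
  split=> [p f Pp Sf|a F G /repT[w Fw] /repT[v Gv]]; first exact/phiE/rep1.
  by rewrite (phiE _ _ (rep_lin a Fw Gv)) (phiE _ _ Fw) (phiE _ _ Gv).
move=> psi [psi1 psiL] F [m [p [f [Pp Sf ->]]]].
have T0 : tensor P S (fun _ _ => 0).
  by exists 0%N, (fun=> fun=> 0), (fun=> fun=> 0); split=> [[]|[]|] //;
     apply/funext => x; apply/funext => y; rewrite big_ord0.
have psi0 : psi (fun _ _ => 0) = 0.
  have := psiL 1 _ _ T0 T0; rewrite scale1r.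
  have -> : (fun (x : X) (y : Y) => (1 : K) * 0 + 0) = (fun _ _ => 0).
    by apply/funext => x; apply/funext => y; rewrite mulr0 addr0.
  by rewrite -{1}[psi _]addr0 => /addrI.
rewrite [RHS](phiE _ (\sum_(k < m) b (p k) (f k))); last by exists m, p, f.
elim: m p f Pp Sf => [|m IH] p f Pp Sf.
  rewrite big_ord0 -psi0; congr psi; apply/funext => x; apply/funext => y.
  by rewrite big_ord0.
have Ppl k : P ((p \o lift ord0) k) by exact: Pp.
have Sfl k : S ((f \o lift ord0) k) by exact: Sf.
rewrite big_ord_recl -(IH (p \o lift ord0) (f \o lift ord0)) //.
rewrite -(psi1 _ _ (Pp _) (Sf _)) -[psi (fun x y => p _ x * _)]scale1r -psiL.
- congr psi; apply/funext => x; apply/funext => y.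
  by rewrite big_ord_recl mul1r.
- exists 1%N, (fun=> p ord0), (fun=> f ord0).
  by split=> //; apply/funext => x; apply/funext => y; rewrite big_ord1.
- by exists m, (p \o lift ord0), (f \o lift ord0).
Qed.

End TensorUniversal.

Section Spaces.
Variable R : realType.

(* R[i] carries no normed module structure over R, so a complex-valued
   function of real variables is differentiated componentwise. *)
Definition pd (m : nat) (j : 'I_m) (f : 'rV[R]_m -> R[i]) : 'rV[R]_m -> R[i] :=
  fun a => 'D_(delta_mx 0 j) (fun u => complex.Re (f u)) a
           +i* 'D_(delta_mx 0 j) (fun u => complex.Im (f u)) a.

Definition has_pd (m : nat) (j : 'I_m) (f : 'rV[R]_m -> R[i]) : Prop :=
  forall a, derivable (fun u => complex.Re (f u)) a (delta_mx 0 j) /\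
            derivable (fun u => complex.Im (f u)) a (delta_mx 0 j).

Definition cont (m : nat) (f : 'rV[R]_m -> R[i]) : Prop :=
  continuous (fun u => complex.Re (f u)) /\ continuous (fun u => complex.Im (f u)).

(* The mixed partial derivative along a list of coordinate directions; letting
   the list vary gives all the derivatives of all orders. *)
Definition pds (m : nat) (s : seq 'I_m) (f : 'rV[R]_m -> R[i]) :=
  foldr (@pd m) f s.

Definition smooth (m : nat) (f : 'rV[R]_m -> R[i]) : Prop :=
  forall s : seq 'I_m, cont (pds s f) /\ forall j, has_pd j (pds s f).

Definition schwartz (m : nat) : set ('rV[R]_m -> R[i]) :=
  [set f | smooth f /\
     forall (alpha : 'I_m -> nat) (s : seq 'I_m), exists M : R,
       forall q : 'rV[R]_m, `|(\prod_(j < m) q 0 j ^+ alpha j)%:C * pds s f q| <= M%:C].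

Definition polyfun (m : nat) : set ('rV[R]_m -> R[i]) :=
  [set p | exists P : mpoly.mpoly m R[i],
     p = fun z : 'rV[R]_m => mpoly.meval (fun i => (z 0 i)%:C) P].

Lemma polyfun_subspace m : is_subspace (@polyfun m).
Proof.
split; first by exists 0; apply/funext => z; rewrite mpoly.meval0.
move=> a _ _ [P ->] [Q ->]; exists (a *: P + Q); apply/funext => z.
by rewrite mpoly.mevalD mpoly.mevalZ.
Qed.

Let pd0 m (j : 'I_m) : pd j (fun=> 0) = fun=> 0.
Proof. by apply/funext => u; rewrite /pd /= derive_cst. Qed.

Let pds0 m (s : seq 'I_m) : pds s (fun=> 0) = fun=> 0.
Proof. by elim: s => //= j s ->; rewrite pd0. Qed.

Let ReL (a z w : R[i]) : complex.Re (a * z + w) =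
  complex.Re a * complex.Re z - complex.Im a * complex.Im z + complex.Re w.
Proof. by case: a z w => [? ?] [? ?] [? ?]. Qed.

Let ImL (a z w : R[i]) : complex.Im (a * z + w) =
  complex.Re a * complex.Im z + complex.Im a * complex.Re z + complex.Im w.
Proof. by case: a z w => [? ?] [? ?] [? ?]. Qed.

Let has_pdL m (j : 'I_m) a f g : has_pd j f -> has_pd j g ->
  has_pd j (fun u => a * f u + g u) /\
  pd j (fun u => a * f u + g u) = fun u => a * pd j f u + pd j g u.
Proof.
move=> Df Dg.
have ReE : (fun u => complex.Re (a * f u + g u)) =
    complex.Re a \*: (fun u => complex.Re (f u))
    - complex.Im a \*: (fun u => complex.Im (f u))
    + (fun u => complex.Re (g u)) by apply/funext => u; rewrite ReL.
have ImE : (fun u => complex.Im (a * f u + g u)) =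
    complex.Re a \*: (fun u => complex.Im (f u))
    + complex.Im a \*: (fun u => complex.Re (f u))
    + (fun u => complex.Im (g u)) by apply/funext => u; rewrite ImL.
have RD u : is_derive u (delta_mx 0 j : 'rV[R]_m)
    (fun u => complex.Re (a * f u + g u))
    (complex.Re (a * pd j f u + pd j g u)).
  have [/derivableP ? /derivableP ?] := Df u.
  have [/derivableP ? /derivableP ?] := Dg u.
  by rewrite ReE ReL /pd /=; apply: is_derive_eq.
have ID u : is_derive u (delta_mx 0 j : 'rV[R]_m)
    (fun u => complex.Im (a * f u + g u))
    (complex.Im (a * pd j f u + pd j g u)).
  have [/derivableP ? /derivableP ?] := Df u.
  have [/derivableP ? /derivableP ?] := Dg u.
  by rewrite ImE ImL /pd /=; apply: is_derive_eq.
split=> [u|]; first by split; apply: ex_derive.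
apply/funext => u; rewrite {1}/pd (@derive_val _ _ _ _ _ _ _ (RD u)).
by rewrite (@derive_val _ _ _ _ _ _ _ (ID u)); case: (_ + _).
Qed.

Let contL m a (f g : 'rV[R]_m -> R[i]) : cont f -> cont g ->
  cont (fun u => a * f u + g u).
Proof.
move=> [fR fI] [gR gI].
have cM (c : R) (h : 'rV[R]_m -> R) u : h @ u --> h u ->
    (fun v => c * h v) @ u --> c * h u
  by move=> hu; exact: (cvgM (cvg_cst c) hu).
split=> u; under eq_fun do rewrite ?ReL ?ImL; rewrite ?ReL ?ImL.
  exact: (cvgD (cvgB (cM _ _ _ (fR u)) (cM _ _ _ (fI u))) (gR u)).
exact: (cvgD (cvgD (cM _ _ _ (fI u)) (cM _ _ _ (fR u))) (gI u)).
Qed.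

Let pdsL m (s : seq 'I_m) a f g : smooth f -> smooth g ->
  pds s (fun u => a * f u + g u) = fun u => a * pds s f u + pds s g u.
Proof.
move=> sf sg; elim: s => //= j s IH; rewrite -/(pds s _) IH.
exact: (has_pdL a ((sf s).2 j) ((sg s).2 j)).2.
Qed.

Lemma schwartz_subspace m : is_subspace (@schwartz m).
Proof.
split.
  split=> [s|alpha s]; rewrite pds0.
    split=> [|j u]; first by split; exact: cst_continuous.
    by split; exact: derivable_cst.
  by exists 0 => q; rewrite mulr0 normr0.
move=> a f g [sf bf] [sg bg]; split=> [s|alpha s]; rewrite pdsL //.
  split=> [|j]; first exact: contL (sf s).1 (sg s).1.
  exact: (has_pdL a ((sf s).2 j) ((sg s).2 j)).1.
have [M fM] := bf alpha s; have [N gN] := bg alpha s.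
exists (complex.Re `|a| * M + N) => q.
rewrite mulrDr mulrCA (le_trans (ler_normD _ _)) // normrM.
rewrite rmorphD rmorphM /= lerD //.
by rewrite (_ : (complex.Re `|a|)%:C = `|a|) ?ler_wpM2l.
Qed.

End Spaces.

Arguments schwartz : clear implicits.
Arguments polyfun : clear implicits.

Section Operators.
Variables (R : realType) (n : nat).

(* A point of R^2n is the row (x_1, ..., x_n, y_1, ..., y_n): [lshift n j] is
   the index of x_j and [rshift n j] that of y_j. *)
Definition spinor_field := 'rV[R]_(n + n) -> 'rV[R]_n -> R[i].

Definition polyspinors : set spinor_field :=
  tensor (polyfun R (n + n)) (schwartz R n).

Definition xc (j : 'I_n) (z : 'rV[R]_(n + n)) : R[i] := (z 0 (lshift n j))%:C.
Definition yc (j : 'I_n) (z : 'rV[R]_(n + n)) : R[i] := (z 0 (rshift n j))%:C.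
Definition qc (j : 'I_n) (q : 'rV[R]_n) : R[i] := (q 0 j)%:C.

Definition dx (j : 'I_n) (F : spinor_field) : spinor_field :=
  fun z q => pd (lshift n j) (fun w => F w q) z.
Definition dy (j : 'I_n) (F : spinor_field) : spinor_field :=
  fun z q => pd (rshift n j) (fun w => F w q) z.
Definition dq (j : 'I_n) (F : spinor_field) : spinor_field :=
  fun z q => pd j (F z) q.

Definition Ds (F : spinor_field) : spinor_field := fun z q =>
  \sum_(j < n) ('i%C * qc j q * dy j F z q - dq j (dx j F) z q).

Definition Dt (F : spinor_field) : spinor_field := fun z q =>
  \sum_(j < n) ('i%C * qc j q * dx j F z q + dy j (dq j F) z q).

Definition opA (j k : 'I_n) (F : spinor_field) : spinor_field := fun z q =>
  yc j z * dx k F z q - xc k z * dy j F z q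
  + yc k z * dx j F z q - xc j z * dy k F z q
  + 'i%C * (qc j q * qc k q * F z q - dq j (dq k F) z q).

Definition opB (j : 'I_n) (F : spinor_field) : spinor_field := fun z q =>
  yc j z * dx j F z q - xc j z * dy j F z q
  + 'i%C / 2 * (qc j q ^+ 2 * F z q - dq j (dq j F) z q).

Definition opC (j k : 'I_n) (F : spinor_field) : spinor_field := fun z q =>
  xc j z * dx k F z q - xc k z * dx j F z q
  + yc j z * dy k F z q - yc k z * dy j F z q
  + qc j q * dq k F z q - qc k q * dq j F z q.

Definition operator := spinor_field -> spinor_field.

Definition scale (a : R[i]) (F : spinor_field) : spinor_field :=
  fun z q => a * F z q.

(* [D] restricts to a C-linear endomorphism of [polyspinors]. *)
Definition is_endo (D : operator) : Prop :=
  (forall F, polyspinors F -> polyspinors (D F)) /\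
  (forall a F G, polyspinors F -> polyspinors G ->
     D (scale a F + G) = scale a (D F) + D G).

(* Operators are only compared on [polyspinors]: elsewhere the partial
   derivatives above may be junk values. *)
Definition eq_op_on (D E : operator) : Prop :=
  forall F, polyspinors F -> D F = E F.

Definition commute_on (D E : operator) : Prop :=
  forall F, polyspinors F -> D (E F) = E (D F).

Definition real_span_ABC (D : operator) : Prop :=
  exists (a c : 'I_n -> 'I_n -> R) (b : 'I_n -> R),
    eq_op_on D (fun F =>
      \sum_(j < n) \sum_(k < n | (j < k)%N) scale (a j k)%:C (opA j k F)
      + \sum_(j < n) scale (b j)%:C (opB j F)
      + \sum_(j < n) \sum_(k < n | (j < k)%N) scale (c j k)%:C (opC j k F)).

(* u(n), as the skew-Hermitian matrices. *)
Definition in_u (X : 'M[R[i]]_n) : Prop := (map_mx (@conjc R) X)^T = - X.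

(* [rho] is an isomorphism of real Lie algebras from u(n) onto the set [L] of
   operators on [polyspinors] with the commutator bracket. *)
Definition u_isomorphism (L : operator -> Prop) (rho : 'M[R[i]]_n -> operator)
    : Prop :=
  [/\ forall (t : R) X Y F, in_u X -> in_u Y -> polyspinors F ->
        rho (t%:C *: X + Y) F = scale t%:C (rho X F) + rho Y F,
      forall X Y F, in_u X -> in_u Y -> polyspinors F ->
        rho (X *m Y - Y *m X) F = rho X (rho Y F) - rho Y (rho X F),
      forall X Y, in_u X -> in_u Y -> eq_op_on (rho X) (rho Y) -> X = Y,
      forall X, in_u X -> L (rho X)
    & forall D, L D -> exists2 X, in_u X & eq_op_on D (rho X)].

End Operators.

(* Main.v *)
Require Import Defs.
From HB Require Import structures.
From mathcomp Require Import all_boot all_order all_algebra.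
From mathcomp Require Import complex ring lra.
From mathcomp.multinomials Require mpoly.
Import (canonicals, coercions) mpoly.
From mathcomp Require Import all_classical all_reals all_analysis.
Import Order.TTheory GRing.Theory Num.Theory numFieldNormedType.Exports.

Set Implicit Arguments.
Unset Strict Implicit.
Unset Printing Implicit Defensive.

Local Open Scope classical_set_scope.
Local Open Scope ring_scope.
Local Open Scope complex_scope.

(** The operators are read off from an action of gl_n(C).  On functions of
    (x, y, q) introduce the complex coordinates
      zeta_j = x_j - i y_j,   zetab_j = x_j + i y_j
    with their derivations dzeta_j, dzetab_j, and the oscillator operators
      create_j = (q_j - d_j) / 2,   annih_j = q_j + d_j.
    These are three mutually commuting families of canonical pairs, and
      E_jk = zeta_j dzeta_k - zetab_k dzetab_j + create_j annih_k + delta_jk / 2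
    satisfies [E_jk, E_lm] = delta_kl E_jm - delta_jm E_lk ([lie_glE]): each
    of the three quadratic expressions is the usual realisation of gl_n by
    operators b_j d_k, the second one being the dual one.  Under the bracket
    with E_jk, the families zeta, dzetab, create transform as a basis of C^n
    and dzeta, zetab, annih as the dual basis, so contractions of a family of
    the first kind with one of the second kind are invariant
    ([lie_glE_contraction]).  Expanding in complex coordinates,
      D_s = 2 sum create_l dzeta_l - sum annih_l dzetab_l,
      D_t = 2 i sum create_l dzeta_l + i sum annih_l dzetab_l
    ([Ds_complex], [Dt_complex]); this is the invariance of D_s and D_t.

    Expanding E_jk in real coordinates ([weylE_real]) gives
      A_jk = i (E_jk + E_kj),   B_jj = i E_jj,   C_jk = E_jk - E_kj,
    so the real span of A, B, C is the image of u(n) under the complex linear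
    map X |-> sum X_jk E_jk ([urep_endo_span]), which respects brackets.  It is
    injective because its bracket with zeta_l is sum_j X_jl zeta_j; applied to
    1 (x) Gaussian this shows that every X_jl is determined.

    These computations take place in the algebra of linear endomorphisms of
    the space of polynomial spinors ([endo]), where the coordinates and the
    partial derivatives satisfy the Weyl relations ([weyl]).  What analysis
    remains is that derivatives and coordinate multiplications preserve
    polynomials and Schwartz functions, that second partial derivatives
    commute ([pdC]), and that the Gaussian is a Schwartz function
    ([schwartz_gaussian]). *)

(** * Calculus of complex-valued functions of several real variables *)

Section ComplexParts.
Variable R : realType.
Implicit Types z w : R[i].

Lemma ReM z w : complex.Re (z * w) =
  complex.Re z * complex.Re w - complex.Im z * complex.Im w.
Proof. by case: z w => [? ?] [? ?]. Qed.

Lemma ImM z w : complex.Im (z * w) =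
  complex.Re z * complex.Im w + complex.Im z * complex.Re w.
Proof. by case: z w => [? ?] [? ?]. Qed.

End ComplexParts.

Section Calculus.
Variables (R : realType) (m : nat).
Implicit Types (f g : 'rV[R]_m -> R[i]) (u v : 'rV[R]_m) (i j k : 'I_m).

(** A pointwise predicate with the value as an argument, so that the rules for
    sums and products need no differentiability side condition. *)
Definition is_pd j f u (d : R[i]) : Prop :=
  is_derive u (delta_mx 0 j : 'rV[R]_m) (fun w => complex.Re (f w)) (complex.Re d) /\
  is_derive u (delta_mx 0 j : 'rV[R]_m) (fun w => complex.Im (f w)) (complex.Im d).

Lemma has_pdP j f : has_pd j f <-> forall u, is_pd j f u (pd j f u).
Proof.
split=> [Df u|Df u]; first by have [/derivableP ? /derivableP ?] := Df u.
by have [? ?] := Df u; split; apply: ex_derive.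
Qed.

Lemma is_pd_val j f u d : is_pd j f u d -> pd j f u = d.
Proof.
by move=> [fr fi]; rewrite /pd !derive_val; case: d {fr fi}.
Qed.

Lemma is_pd_funP j f g :
  (forall u, is_pd j f u (g u)) -> has_pd j f /\ pd j f = g.
Proof.
move=> fg; have E : pd j f = g by apply/funext => u; exact: is_pd_val.
by split=> //; apply/has_pdP => u; rewrite E.
Qed.

Lemma is_pd_cst j (c : R[i]) u : is_pd j (fun=> c) u 0.
Proof. by split; apply: is_derive_cst. Qed.

Lemma is_pdD j f g u c d : is_pd j f u c -> is_pd j g u d ->
  is_pd j (fun w => f w + g w) u (c + d).
Proof.
move=> [fr fi] [gr gi]; split.
  rewrite (_ : (fun _ => _) = (fun w => complex.Re (f w)) + (fun w => complex.Re (g w))).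
    by apply: (is_derive_eq (is_deriveD fr gr)); case: c d {fr fi gr gi} => ? ? [].
  by apply/funext => w /=; rewrite raddfD.
rewrite (_ : (fun _ => _) = (fun w => complex.Im (f w)) + (fun w => complex.Im (g w))).
  by apply: (is_derive_eq (is_deriveD fi gi)); case: c d {fr fi gr gi} => ? ? [].
by apply/funext => w /=; rewrite raddfD.
Qed.

Lemma is_pdM j f g u c d : is_pd j f u c -> is_pd j g u d ->
  is_pd j (fun w => f w * g w) u (c * g u + f u * d).
Proof.
move=> [fr fi] [gr gi]; split.
  rewrite (_ : (fun _ => _) = (fun w => complex.Re (f w)) * (fun w => complex.Re (g w))
    - (fun w => complex.Im (f w)) * (fun w => complex.Im (g w))).
    apply: (is_derive_eq (is_deriveB (is_deriveM fr gr) (is_deriveM fi gi))).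
    case: c d (f u) (g u) {fr fi gr gi} => ? ? [? ?] [? ?] [? ?] /=.
    by rewrite /GRing.scale /=; ring.
  by apply/funext => w; rewrite ReM.
rewrite (_ : (fun _ => _) = (fun w => complex.Re (f w)) * (fun w => complex.Im (g w))
    + (fun w => complex.Im (f w)) * (fun w => complex.Re (g w))).
  apply: (is_derive_eq (is_deriveD (is_deriveM fr gi) (is_deriveM fi gr))).
  case: c d (f u) (g u) {fr fi gr gi} => ? ? [? ?] [? ?] [? ?] /=.
  by rewrite /GRing.scale /=; ring.
by apply/funext => w; rewrite ImM.
Qed.

Definition coord k u : R[i] := (u 0 k)%:C.

Lemma is_pd_real j (h : 'rV[R]_m -> R) u (d : R) :
  is_derive u (delta_mx 0 j : 'rV[R]_m) h d -> is_pd j (fun w => (h w)%:C) u d%:C.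
Proof. by move=> ?; split => //; apply: is_derive_cst. Qed.

Lemma is_derive_coord (v u : 'rV[R]_m) k :
  is_derive u v (fun w : 'rV[R]_m => w 0 k) (v 0 k).
Proof.
have lin : linear (fun w : 'rV[R]_m => w 0 k) by move=> c x y; rewrite !mxE.
pose l := GRing.isLinear.Build _ _ _ _ _ lin.
pose L : {linear 'rV[R]_m -> R} := HB.pack (fun w : 'rV[R]_m => w 0 k) l.
have cL : continuous L by exact: coord_continuous.
have dL : differentiable L u by exact: linear_differentiable.
split; first exact: diff_derivable.
by rewrite (deriveE v dL) (diff_lin _ cL).
Qed.

Lemma is_pd_coord j k u : is_pd j (coord k) u (j == k)%:R.
Proof.
rewrite -(rmorph_nat (real_complex R)).
apply: is_pd_real; rewrite (_ : (j == k)%:R = (delta_mx 0 j : 'rV[R]_m) 0 k).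
  exact: is_derive_coord.
by rewrite mxE eqxx eq_sym.
Qed.

Lemma contD f g : cont f -> cont g -> cont (fun u => f u + g u).
Proof.
move=> [fR fI] [gR gI]; split=> u; under eq_fun do rewrite raddfD; rewrite ?raddfD.
  exact: (cvgD (fR u) (gR u)).
exact: (cvgD (fI u) (gI u)).
Qed.

Lemma contM f g : cont f -> cont g -> cont (fun u => f u * g u).
Proof.
move=> [fR fI] [gR gI]; split=> u; under eq_fun do rewrite ?ReM ?ImM; rewrite ?ReM ?ImM.
  exact: (cvgB (cvgM (fR u) (gR u)) (cvgM (fI u) (gI u))).
exact: (cvgD (cvgM (fR u) (gI u)) (cvgM (fI u) (gR u))).
Qed.

Lemma cont_cst (c : R[i]) : cont (fun _ : 'rV[R]_m => c).
Proof. by split; exact: cst_continuous. Qed.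

Lemma cont_real (h : 'rV[R]_m -> R) : continuous h -> cont (fun u => (h u)%:C).
Proof. by move=> ch; split; [exact: ch|exact: cst_continuous]. Qed.

Lemma cont_coord k : cont (coord k).
Proof. by apply: cont_real => u; exact: coord_continuous. Qed.

End Calculus.

(** * Symmetry of second partial derivatives *)

Section Symmetry.
Variables (R : realType) (V : normedModType R).
Implicit Types (h : V -> R) (u v w : V).

Lemma is_derive_line h u v (t d : R) :
  is_derive (u + t *: v) v h d -> is_derive t (1 : R) (fun s : R => h (u + s *: v)) d.
Proof.
move=> [hd hE].
have E : (fun r : R => r^-1 *: (((fun s : R => h (u + s *: v)) \o shift t) (r *: (1 : R))
      - h (u + t *: v))) =
    (fun r : R => r^-1 *: ((h \o shift (u + t *: v)) (r *: v) - h (u + t *: v))).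
  apply/funext => r /=; rewrite [r *: 1]mulr1 scalerDl.
  by rewrite addrCA.
by split; [rewrite /derivable E|rewrite /derive E].
Qed.

Lemma MVT_line h (dh : V -> R) u v (e : R) : 0 <= e ->
  (forall w, is_derive w v h (dh w)) ->
  exists2 t, t \in `[0, e]%R & h (u + e *: v) - h u = dh (u + t *: v) * e.
Proof.
move=> e0 hd.
have gd (t : R) : is_derive t (1 : R) (fun s : R => h (u + s *: v)) (dh (u + t *: v)).
  exact: is_derive_line.
have [t te E] := @MVT_segment _ _ (fun t => dh (u + t *: v)) _ _ e0 (fun t _ => gd t)
  (@derivable_within_continuous _ _ _ _ (fun t _ => @ex_derive _ _ _ _ _ _ _ (gd t))).
by exists t => //; rewrite scale0r addr0 subr0 in E.
Qed.

(** The second difference of [h] over a parallelogram is a second derivative at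
    an intermediate point: the mean value theorem is applied first to the
    increment of [h] along [w], as a function on the side along [v], and then
    along [w]. *)
Lemma MVT2 h (dv dwv : V -> R) u v w (e : R) : 0 <= e ->
  (forall x, is_derive x v h (dv x)) -> (forall x, is_derive x w dv (dwv x)) ->
  exists s t, [/\ s \in `[0, e]%R, t \in `[0, e]%R &
    h (u + e *: v + e *: w) - h (u + e *: v) - (h (u + e *: w) - h u) =
    dwv (u + s *: v + t *: w) * e ^+ 2].
Proof.
move=> e0 hv hwv.
have gd x : is_derive x v (fun x => h (x + e *: w) - h x) (dv (x + e *: w) - dv x).
  have hs : is_derive x v (fun x => h (x + e *: w)) (dv (x + e *: w)).
    have [h1 h2] := hv (x + e *: w).
    have E : (fun r : R => r^-1 *: (((fun x => h (x + e *: w)) \o shift x) (r *: v)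
       - h (x + e *: w))) =
     (fun r : R => r^-1 *: ((h \o shift (x + e *: w)) (r *: v) - h (x + e *: w))).
      by apply/funext => r /=; rewrite addrA.
    by split; [rewrite /derivable E|rewrite /derive E].
  exact: is_deriveB.
have [s se /= E1] := MVT_line u e0 gd.
have [t te E2] := MVT_line (u + s *: v) e0 hwv.
exists s, t; split=> //; rewrite E1 E2; ring.
Qed.

(** The second difference is symmetric in [v] and [w], so the two mixed
    derivatives take a common value at points arbitrarily close to [u]; by
    continuity they agree at [u]. *)
Lemma derive_sym h (dv dw dwv dvw : V -> R) v w :
  (forall x, is_derive x v h (dv x)) -> (forall x, is_derive x w h (dw x)) ->
  (forall x, is_derive x w dv (dwv x)) -> (forall x, is_derive x v dw (dvw x)) ->
  continuous dwv -> continuous dvw -> dwv = dvw.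
Proof.
move=> hv hw hwv hvw cwv cvw; apply/funext => u; apply/eqP; rewrite -subr_eq0 -normr_eq0.
rewrite eq_le normr_ge0 andbT; apply/ler_addgt0Pr => eps eps0; rewrite add0r.
have cp (a b : V) : (u + p.1 *: a + p.2 *: b) @[p --> (0, 0) : R * R] --> u.
  rewrite -[X in _ --> X]addr0 -[X in _ --> X + _]addr0.
  rewrite -[X in _ --> _ + X + _](scale0r a) -[X in _ --> _ + X](scale0r b).
  apply: cvgD; first apply: cvgD; first exact: cvg_cst.
    by apply: cvgZ; [exact: cvg_fst|exact: cvg_cst].
  by apply: cvgZ; [exact: cvg_snd|exact: cvg_cst].
have nr (d : V -> R) a b : continuous d -> \forall p \near (0, 0) : R * R,
    `|d u - d (u + p.1 *: a + p.2 *: b)| < eps / 2.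
  move=> cd; have := cvg_comp _ _ (cp a b) (cd u).
  by move=> /cvgrPdist_lt; apply; rewrite divr_gt0.
have /nbhs_ballP[/= e e0 H] : \forall p \near (0, 0) : R * R,
    `|dwv u - dwv (u + p.1 *: v + p.2 *: w)| < eps / 2 /\
    `|dvw u - dvw (u + p.1 *: w + p.2 *: v)| < eps / 2.
  near=> p; split; near: p; exact: nr.
have e20 : 0 <= e / 2 by rewrite divr_ge0 // ltW.
have [s [t [se te E1]]] := MVT2 u e20 hv hwv.
have [s' [t' [se' te' E2]]] := MVT2 u e20 hw hvw.
have bl r : r \in `[0, e / 2] -> ball (0 : R) e r.
  rewrite in_itv /= => /andP[r0 re].
  rewrite /ball /= sub0r normrN ger0_norm //; lra.
have [H1 _] := H (s, t) (conj (bl s se) (bl t te)).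
have [_ H2] := H (s', t') (conj (bl s' se') (bl t' te')).
have E : dwv (u + s *: v + t *: w) = dvw (u + s' *: w + t' *: v).
  have e2 : (e / 2) ^+ 2 != 0 by rewrite expf_neq0 // gt_eqF // divr_gt0.
  apply: (mulIf e2); rewrite -E1 -E2 [u + _ + _ in RHS]addrAC; ring.
rewrite /= in H1 H2; rewrite E in H1.
rewrite -(subrK (dvw (u + s' *: w + t' *: v)) (dwv u)) -addrA.
rewrite (le_trans (ler_normD _ _)) // [eps](splitr eps) lerD // ltW //.
by rewrite distrC.
Unshelve. all: by end_near.
Qed.

End Symmetry.

Lemma pdC (R : realType) m (i j : 'I_m) (f : 'rV[R]_m -> R[i]) :
  smooth f -> pd i (pd j f) = pd j (pd i f).
Proof.
move=> sf.
have [_ Df] := sf [::]; rewrite /= in Df.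
have pj k : forall u, is_pd k f u (pd k f u) by apply/has_pdP.
have pjk k l : forall u, is_pd k (pd l f) u (pd k (pd l f) u).
  by apply/has_pdP; have [_] := sf [:: l]; apply.
have [cRij cIij] := (sf [:: i; j]).1; have [cRji cIji] := (sf [:: j; i]).1.
have RE := derive_sym (fun u => (pj j u).1) (fun u => (pj i u).1)
  (fun u => (pjk i j u).1) (fun u => (pjk j i u).1) cRij cRji.
have IE := derive_sym (fun u => (pj j u).2) (fun u => (pj i u).2)
  (fun u => (pjk i j u).2) (fun u => (pjk j i u).2) cIij cIji.
apply/funext => u; apply/eqP; rewrite eq_complex.
by apply/andP; split; apply/eqP;
  [exact: (congr1 (fun h => h u) RE)|exact: (congr1 (fun h => h u) IE)].
Qed.

(** * Polynomials, Schwartz functions and the Gaussian *)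

Section Classes.
Variables (R : realType) (m : nat).
Local Notation fct := ('rV[R]_m -> R[i]).
Implicit Types (f g h : fct) (u : 'rV[R]_m) (j k : 'I_m) (s : seq 'I_m).

Lemma pd_lin j (a : R[i]) f g : has_pd j f -> has_pd j g ->
  has_pd j (fun u => a * f u + g u) /\
  pd j (fun u => a * f u + g u) = fun u => a * pd j f u + pd j g u.
Proof.
move=> /has_pdP Df /has_pdP Dg; apply: is_pd_funP => u.
by have := is_pdD (is_pdM (is_pd_cst j a u) (Df u)) (Dg u); rewrite mul0r add0r.
Qed.

Lemma pd_coordM j k f : has_pd j f ->
  has_pd j (fun u => coord k u * f u) /\
  pd j (fun u => coord k u * f u) =
    fun u => (j == k)%:R * f u + coord k u * pd j f u.
Proof.
by move=> /has_pdP Df; apply: is_pd_funP => u; exact: is_pdM (is_pd_coord j k u) (Df u).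
Qed.

(** Smoothness is coinductive: it suffices to exhibit a class of functions
    closed under the partial derivatives whose members are continuous and
    differentiable in each coordinate. *)
Lemma smooth_coind (C : set fct) :
  (forall f, C f -> [/\ cont f, forall j, has_pd j f & forall j, C (pd j f)]) ->
  C `<=` @smooth R m.
Proof.
move=> HC f Cf s; suff /HC[? ? _] : C (pds s f) by [].
by elim: s => //= j s /HC[_ _]; apply.
Qed.

Lemma smooth_pd j f : smooth f -> smooth (pd j f).
Proof. by move=> sf s; have := sf (rcons s j); rewrite /pds foldr_rcons. Qed.

(** The decay condition on the function alone; [schwartz] asks it of every
    iterated derivative. *)
Definition rapid f : Prop := forall alpha : 'I_m -> nat, exists M : R,
  forall q : 'rV[R]_m, `|(\prod_(j < m) q 0 j ^+ alpha j)%:C * f q| <= M%:C.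

Lemma rapid_lin (a : R[i]) f g : rapid f -> rapid g -> rapid (fun q => a * f q + g q).
Proof.
move=> bf bg alpha; have [M fM] := bf alpha; have [N gN] := bg alpha.
exists (complex.Re `|a| * M + N) => q.
rewrite mulrDr mulrCA (le_trans (ler_normD _ _)) // normrM.
rewrite rmorphD rmorphM /= lerD // (_ : (complex.Re `|a|)%:C = `|a|) ?ler_wpM2l //.
Qed.

Lemma rapid_coordM k f : rapid f -> rapid (fun q => coord k q * f q).
Proof.
move=> bf alpha; have [M fM] := bf (fun j => alpha j + (j == k))%N.
exists M => q; have := fM q; rewrite mulrA -rmorphM; congr (`|_%:C * _| <= _).
under eq_bigr do rewrite exprD; rewrite big_split /=; congr (_ * _).
by rewrite (bigD1 k) //= eqxx big1 ?mulr1 // => j /negbTE ->.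
Qed.

Lemma schwartz_rapid f : schwartz R m f -> rapid f.
Proof. by move=> [_ /(_ _ [::])]. Qed.

Lemma schwartz_coind (C : set fct) :
  (forall f, C f ->
    [/\ cont f, rapid f, forall j, has_pd j f & forall j, C (pd j f)]) ->
  C `<=` schwartz R m.
Proof.
move=> HC f Cf; split.
  by apply: (@smooth_coind C) Cf => g /HC[].
move=> alpha s; suff /HC[_ + _ _] : C (pds s f) by apply.
by elim: s => //= j s /HC[_ _ _]; apply.
Qed.

Lemma schwartz_pd j f : schwartz R m f -> schwartz R m (pd j f).
Proof.
move=> [sf bf]; split=> [|alpha s]; first exact: smooth_pd.
by have := bf alpha (rcons s j); rewrite /pds foldr_rcons.
Qed.

Lemma schwartz_smooth : schwartz R m `<=` @smooth R m.
Proof. by move=> f []. Qed.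

Lemma schwartz_has_pd j f : schwartz R m f -> has_pd j f.
Proof. by move=> [/(_ [::])[_]]. Qed.

Lemma schwartz_cont f : schwartz R m f -> cont f.
Proof. by move=> [/(_ [::])[]]. Qed.

(** The functions [coord k * g + h] with [g], [h] Schwartz are closed under the
    partial derivatives, by the Leibniz rule; this avoids a formula for the
    iterated derivatives of a product. *)
Lemma schwartz_coordM k f : schwartz R m f -> schwartz R m (fun q => coord k q * f q).
Proof.
have [S0 SL] := schwartz_subspace R m.
pose C : set fct := [set f | exists g h, [/\ schwartz R m g, schwartz R m h &
  f = fun q => 1 * (coord k q * g q) + h q]].
suff CS : C `<=` schwartz R m.
  move=> Sf; apply: CS; exists f, (fun=> 0); split=> //.
  by apply/funext => q; rewrite mul1r addr0.
apply: schwartz_coind => _ [g [h [Sg Sh ->]]].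
have Dk j := pd_coordM k (schwartz_has_pd j Sg).
have D j := pd_lin 1 (Dk j).1 (schwartz_has_pd j Sh).
split=> [||j|j].
- by apply: contD; [apply: contM; [exact: cont_cst|apply: contM;
    [exact: cont_coord|exact: schwartz_cont]]|exact: schwartz_cont].
- apply: rapid_lin; last exact: schwartz_rapid.
  exact/rapid_coordM/schwartz_rapid.
- exact: (D j).1.
exists (pd j g), (fun q => (j == k)%:R * g q + pd j h q); split.
- exact: schwartz_pd.
- by apply: SL => //; exact: schwartz_pd.
rewrite (D j).2 (Dk j).2; apply/funext => q; ring.
Qed.

Lemma polyfun_cst (c : R[i]) : polyfun R m (fun=> c).
Proof. by exists (mpoly.mpolyC _ c); apply/funext => z; rewrite mpoly.mevalC. Qed.

Lemma polyfun_coordM k p : polyfun R m p -> polyfun R m (fun z => coord k z * p z).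
Proof.
move=> [P ->]; exists (mpoly.mpolyX _ (mpoly.mnm1 k) * P).
by apply/funext => z; rewrite mpoly.mevalM mpoly.mevalXU.
Qed.

(** Polynomial functions are the smallest subspace that contains 1 and is closed
    under multiplication by the coordinates.  Their calculus and the decay of
    a polynomial times the Gaussian are proved by this induction. *)
Lemma polyfun_ind (C : set fct) :
  C (fun=> 1) -> (forall a p p', C p -> C p' -> C (fun z => a * p z + p' z)) ->
  (forall k p, C p -> C (fun z => coord k z * p z)) -> polyfun R m `<=` C.
Proof.
move=> C1 CL CM; have C0 : C (fun=> 0).
  rewrite (_ : (fun=> 0) = fun z => (- 1) * (fun=> 1) z + (fun=> 1) z) /=.
    exact: CL.
  by apply/funext => z; rewrite mulr1 addNr.
have CX f (a : 'I_m -> nat) : C f -> C (fun z => (\prod_(j < m) coord j z ^+ a j) * f z).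
  move=> Cf; elim: index_enum => [|j s IH].
    by under eq_fun do rewrite big_nil mul1r.
  under eq_fun do rewrite big_cons -mulrA.
  elim: (a j) => [|d IHd]; first by under eq_fun do rewrite mul1r.
  by under eq_fun do rewrite exprS -mulrA; exact: CM.
move=> _ [P ->]; elim/mpoly.mpolyind: P => [|c M P _ _ CP].
  by under eq_fun do rewrite mpoly.meval0.
under eq_fun do rewrite mpoly.mevalD mpoly.mevalZ mpoly.mevalX.
by apply: CL => //; have := CX _ M C1; under eq_fun do rewrite mulr1.
Qed.

Lemma polyfun_calculus p : polyfun R m p ->
  [/\ cont p, forall j, has_pd j p & forall j, polyfun R m (pd j p)].
Proof.
have [P0 PL] := polyfun_subspace R m.
move=> Pp; suff [] : [/\ polyfun R m p, cont p, forall j, has_pd j p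
  & forall j, polyfun R m (pd j p)] by [].
move: p Pp; apply: polyfun_ind =>
  [|a p p' [Pp cp dp Pdp] [Pp' cp' dp' Pdp']|k p [Pp cp dp Pdp]].
- have D j := is_pd_funP (is_pd_cst j (1 : R[i])); split=> [||j|j].
  + exact: polyfun_cst.
  + exact: cont_cst.
  + exact: (D j).1.
  + by rewrite (D j).2.
- have D j := pd_lin a (dp j) (dp' j); split=> [||j|j].
  + exact: PL.
  + by apply: contD => //; apply: contM => //; exact: cont_cst.
  + exact: (D j).1.
  + by rewrite (D j).2; exact: PL.
- have D j := pd_coordM k (dp j); split=> [||j|j].
  + exact: polyfun_coordM.
  + by apply: contM => //; exact: cont_coord.
  + exact: (D j).1.
  + by rewrite (D j).2; apply: PL => //; exact: polyfun_coordM.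
Qed.

Lemma polyfun_smooth : polyfun R m `<=` @smooth R m.
Proof. exact: smooth_coind polyfun_calculus. Qed.

End Classes.

Section Gaussian.
Variables (R : realType).

(** The restriction to the line through [u] along [v] reduces this chain rule
    for directional derivatives to functions of one variable. *)
Lemma is_derive_comp (V : normedModType R) (h : V -> R) (e : R -> R) u v (d c : R) :
  is_derive u v h d -> is_derive (h u) (1 : R) e c ->
  is_derive u v (e \o h) (c * d).
Proof.
move=> hd ed.
have hl : is_derive (0 : R) (1 : R) (fun s : R => h (u + s *: v)) d.
  by apply: is_derive_line; rewrite scale0r addr0.
have el : is_derive (h (u + (0 : R) *: v)) (1 : R) e c by rewrite scale0r addr0.
have [cl dl] := is_derive1_comp el hl.
have E : (fun r : R => r^-1 *:
      (((fun s : R => e (h (u + s *: v))) \o shift 0) (r *: (1 : R))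
      - e (h (u + (0 : R) *: v)))) =
    (fun r : R => r^-1 *: (((e \o h) \o shift u) (r *: v) - (e \o h) u)).
  by apply/funext => r /=; rewrite [_%:A]mulr1 addr0 scale0r addr0 (addrC u).
rewrite /derivable E in cl; rewrite /derive E in dl.
by split=> //; rewrite dl mulrC.
Qed.

(** Since |s| <= 1 + s^2, it is enough to bound t^(2k) exp(- t^2 / 2), and
    (t^2 / 2)^k <= k! exp(t^2 / 2) by the exponential series. *)
Lemma powM_gauss_bounded (k : nat) : exists M : R, forall t : R,
  `|t ^+ k * expR (- (t ^+ 2 / 2))| <= M.
Proof.
exists (1 + 2 ^+ k * k`!%:R) => t.
have t20 : 0 <= t ^+ 2 / 2 by rewrite divr_ge0 // sqr_ge0.
have e1 : 1 <= expR (t ^+ 2 / 2) by apply: le_trans (expR_ge1Dx _); rewrite lerDl.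
have e2 : (t ^+ 2 / 2) ^+ k <= k`!%:R * expR (t ^+ 2 / 2).
  case: k => [|k]; first by rewrite fact0 mul1r.
  rewrite [leRHS]mulrC -ler_pdivrMr ?ltr0n ?fact_gt0 //.
  by apply: le_trans (expR_ge1Dxn k t20); rewrite lerDr.
have E : t ^+ k * t ^+ k = 2 ^+ k * (t ^+ 2 / 2) ^+ k.
  by rewrite -exprMn -exprMn mulrCA divff // mulr1 expr2.
rewrite normrM (ger0_norm (expR_ge0 _)) expRN ler_pdivrMr ?expR_gt0 //.
have : `|t ^+ k| <= 1 + t ^+ k * t ^+ k.
  by rewrite -expr2 -real_normK ?num_real //; have := sqr_ge0 (`|t ^+ k| - 1); nra.
have : 2 ^+ k * (t ^+ 2 / 2) ^+ k <= 2 ^+ k * (k`!%:R * expR (t ^+ 2 / 2)).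
  by rewrite ler_wpM2l // exprn_ge0.
rewrite E; lra.
Qed.

Variable m : nat.

Definition gaussian (q : 'rV[R]_m) : R[i] := (expR (- (\sum_(j < m) q 0 j ^+ 2) / 2))%:C.

Lemma is_pd_gaussian j q : is_pd j gaussian q (- coord j q * gaussian q).
Proof.
rewrite /coord /gaussian -rmorphN -rmorphM mulrC; apply: is_pd_real.
pose h (w : 'rV[R]_m) : R := - (\sum_(j < m) w 0 j ^+ 2) / 2.
apply: (@is_derive_comp _ h (@expR R)).
have sq k : is_derive q (delta_mx 0 j : 'rV[R]_m) (fun w : 'rV[R]_m => w 0 k ^+ 2)
    (2 * q 0 k * (j == k)%:R).
  have := is_derive_coord (delta_mx 0 j) q k; rewrite mxE eqxx eq_sym /= => ck.
  rewrite (_ : (fun _ => _) = (fun w : 'rV[R]_m => w 0 k) * (fun w : 'rV[R]_m => w 0 k)).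
    by apply: is_derive_eq; rewrite /GRing.scale /=; ring.
  by apply/funext => w; rewrite expr2.
rewrite (_ : h = (- 2^-1) \*: \sum_(k < m) (fun w : 'rV[R]_m => w 0 k ^+ 2)).
  apply: is_derive_eq; rewrite (bigD1 j) //= big1 => [|k /negbTE jk].
    by rewrite eqxx /GRing.scale /= addr0 mulr1 mulNr mulKf.
  by rewrite eq_sym jk mulr0.
by apply/funext => w; rewrite /h /= fct_sumE /GRing.scale /=; ring.
Qed.

Lemma cont_gaussian : cont gaussian.
Proof.
have sq (r : seq 'I_m) :
    continuous (fun q : 'rV[R]_m => \sum_(j <- r) q 0 j ^+ 2).
  elim: r => [|j r IH] q.
    by under eq_fun do rewrite big_nil; exact: cst_continuous.
  under eq_fun do rewrite big_cons expr2; rewrite ?big_cons ?expr2.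
  by apply: cvgD (IH q); apply: cvgM; exact: coord_continuous.
have ch : continuous (fun q : 'rV[R]_m => - (\sum_(j < m) q 0 j ^+ 2) / 2).
  by move=> q; exact: (cvgM (cvgN (sq _ q)) (cvg_cst _)).
apply: cont_real => q.
exact: (continuous_comp (ch q) (@continuous_expR _ _)).
Qed.

Lemma gaussian0 : gaussian 0 = 1.
Proof.
by rewrite /gaussian big1 ?oppr0 ?mul0r ?expR0 // => j _; rewrite mxE expr0n.
Qed.

(** The Gaussian is the product of the one-variable Gaussians of the
    coordinates. *)
Lemma rapid_gaussian : rapid gaussian.
Proof.
move=> alpha.
have /choice[M MP] (j : 'I_m) := powM_gauss_bounded (alpha j).
exists (\prod_j M j) => q; rewrite -rmorphM /= normc_def /= expr0n addr0 sqrtr_sqr lecR.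
rewrite mulNr mulr_suml -sumrN expR_sum -big_split normr_prod /=.
by apply: ler_prod => j _; rewrite normr_ge0 MP.
Qed.

(** Polynomial multiples of the Gaussian are closed under the partial
    derivatives, because the derivative of the Gaussian along the [j]-th axis
    is [- coord j] times the Gaussian. *)
Lemma schwartz_gaussian : schwartz R m gaussian.
Proof.
pose C : set ('rV[R]_m -> R[i]) := [set f | exists2 p, polyfun R m p &
  f = fun q => p q * gaussian q].
suff CS : C `<=` schwartz R m.
  apply: CS; exists (fun=> 1); first exact: polyfun_cst.
  by apply/funext => q; rewrite mul1r.
apply: schwartz_coind => _ [p Pp ->]; have [cp dp Pdp] := polyfun_calculus Pp.
have Dg j : has_pd j gaussian by have [] := is_pd_funP (is_pd_gaussian j).
have D j : has_pd j (fun q => p q * gaussian q) /\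
    pd j (fun q => p q * gaussian q) =
    fun q => (-1 * (coord j q * p q) + pd j p q) * gaussian q.
  apply: is_pd_funP => q; have /has_pdP pq := dp j.
  have := is_pdM (pq q) (is_pd_gaussian j q); congr is_pd; ring.
split=> [||j|j].
- by apply: contM => //; exact: cont_gaussian.
- move: p Pp {cp dp Pdp D}; apply: polyfun_ind => [|a p p' rp rp'|k p rp].
  + by under eq_fun do rewrite mul1r; exact: rapid_gaussian.
  + by under eq_fun do rewrite mulrDl -mulrA; exact: rapid_lin.
  + by under eq_fun do rewrite -mulrA; exact: rapid_coordM.
- exact: (D j).1.
exists (fun q => -1 * (coord j q * p q) + pd j p q); last exact: (D j).2.
by apply: (polyfun_subspace R m).2 => //; exact: polyfun_coordM.
Qed.

End Gaussian.

(** * An action of gl_n on three families of canonical pairs *)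

Section Commutator.
Variables (K : fieldType) (A : algType K).
Implicit Types (a b c : A) (k : K).

Definition lie a b : A := a * b - b * a.

Lemma lieC a b : lie b a = - lie a b.
Proof. by rewrite /lie opprB. Qed.

Lemma lieDl a b c : lie (a + b) c = lie a c + lie b c.
Proof. by rewrite /lie mulrDl mulrDr opprD addrACA. Qed.

Lemma lieDr a b c : lie c (a + b) = lie c a + lie c b.
Proof. by rewrite /lie mulrDl mulrDr opprD addrACA. Qed.

Lemma lieZl k a b : lie (k *: a) b = k *: lie a b.
Proof. by rewrite /lie -scalerAl -scalerAr scalerBr. Qed.

Lemma lieZr k a b : lie b (k *: a) = k *: lie b a.
Proof. by rewrite /lie -scalerAl -scalerAr scalerBr. Qed.

Lemma lieNl a b : lie (- a) b = - lie a b.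
Proof. by rewrite -!scaleN1r lieZl. Qed.

Lemma lieNr a b : lie b (- a) = - lie b a.
Proof. by rewrite -!scaleN1r lieZr. Qed.

Lemma lie_suml I (r : seq I) (P : pred I) (f : I -> A) b :
  lie (\sum_(i <- r | P i) f i) b = \sum_(i <- r | P i) lie (f i) b.
Proof. by rewrite /lie mulr_suml mulr_sumr -sumrB. Qed.

Lemma lie_sumr I (r : seq I) (P : pred I) (f : I -> A) b :
  lie b (\sum_(i <- r | P i) f i) = \sum_(i <- r | P i) lie b (f i).
Proof. by rewrite /lie mulr_suml mulr_sumr -sumrB. Qed.

Lemma lieMr a b c : lie a (b * c) = lie a b * c + b * lie a c.
Proof. by rewrite /lie mulrBl mulrBr !mulrA addrA subrK. Qed.

Lemma lieMl a b c : lie (a * b) c = a * lie b c + lie a c * b.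
Proof. by rewrite /lie mulrBl mulrBr !mulrA addrA subrK. Qed.

Lemma lie_alg k a : lie k%:A a = 0.
Proof. by rewrite /lie -scalerAl -scalerAr mul1r mulr1 subrr. Qed.

Lemma mulr_lin2 (a1 a2 b1 b2 : A) (k1 k2 l1 l2 : K) :
  (k1 *: a1 + k2 *: a2) * (l1 *: b1 + l2 *: b2) =
  (k1 * l1) *: (a1 * b1) + (k1 * l2) *: (a1 * b2)
  + (k2 * l1) *: (a2 * b1) + (k2 * l2) *: (a2 * b2).
Proof.
by rewrite mulrDl !mulrDr -!scalerAl -!scalerAr !scalerA addrA.
Qed.

End Commutator.

Section GlAction.
Variables (K : fieldType) (A : algType K) (n : nat).
Variables (u pu w pw c a : 'I_n -> A).

(** The canonical commutation relations of coordinates [b] and derivations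
    [d]. *)
Definition pair_at (b d : 'I_n -> A) : Prop :=
  [/\ forall j k, lie (b j) (b k) = 0, forall j k, lie (d j) (d k) = 0
    & forall j k, lie (d j) (b k) = (j == k)%:R].

Definition commuting (f g : 'I_n -> A) : Prop := forall j k, lie (f j) (g k) = 0.

Definition independent (b d b' d' : 'I_n -> A) : Prop :=
  [/\ commuting b b', commuting b d', commuting d b' & commuting d d'].

Lemma commutingC f g : commuting f g -> commuting g f.
Proof. by move=> fg j k; rewrite lieC fg oppr0. Qed.

Lemma lie_pairl b d j k l : pair_at b d -> lie (b j * d k) (b l) = (k == l)%:R *: b j.
Proof.
by move=> [bb _ db]; rewrite lieMl bb db mul0r addr0 mulr_natr scaler_nat.
Qed.

Lemma lie_pairr b d j k l : pair_at b d -> lie (b j * d k) (d l) = - ((j == l)%:R *: d k).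
Proof.
move=> [_ dd db]; rewrite lieMl dd mulr0 add0r lieC db mulNr.
by rewrite [l == j]eq_sym mulr_natl scaler_nat.
Qed.

Lemma lie_mul0 (f g h : 'I_n -> A) j k l :
  commuting f h -> commuting g h -> lie (f j * g k) (h l) = 0.
Proof. by move=> fh gh; rewrite lieMl fh gh mulr0 mul0r addr0. Qed.

Hypotheses (Hu : pair_at u pu) (Hw : pair_at w pw) (Hc : pair_at c a).
Hypotheses (Huw : independent u pu w pw) (Huc : independent u pu c a)
  (Hwc : independent w pw c a).

(** The images of the elementary matrices.  For one canonical pair, [b j * d k]
    satisfies the relations of gl_n; so does [- b k * d j], the dual
    representation.  The scalar term does not affect the brackets (it vanishes
    on commutators, being a multiple of the trace); it turns the oscillator
    part into the symmetrised form (q_j q_k - d_j d_k) / 2 + (q_j d_k - q_k d_j) / 2,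
    which has no constant term. *)
Definition glE (j k : 'I_n) : A :=
  u j * pu k - w k * pw j + c j * a k + (2^-1 * (j == k)%:R)%:A.

(** Families on which the bracket with [glE] acts as on the coordinate functions
    of C^n, respectively as on its derivations. *)
Definition covector (v : 'I_n -> A) : Prop :=
  forall j k l, lie (glE j k) (v l) = (k == l)%:R *: v j.

Definition contravector (v : 'I_n -> A) : Prop :=
  forall j k l, lie (glE j k) (v l) = - ((j == l)%:R *: v k).

Let expand := (lieDl, lieNl, lie_alg, addr0).

Lemma covector_u : covector u.
Proof.
have [uw up wu wp] := Huw; have [uc ua pc pa] := Huc.
move=> j k l; rewrite /glE !expand (lie_pairl _ _ _ Hu).
by rewrite !lie_mul0 ?subr0 ?addr0 //; exact: commutingC.
Qed.

Lemma contravector_pu : contravector pu.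
Proof.
have [uw up wu wp] := Huw; have [uc ua pc pa] := Huc.
move=> j k l; rewrite /glE !expand (lie_pairr _ _ _ Hu).
by rewrite !lie_mul0 ?subr0 ?addr0 //; exact: commutingC.
Qed.

Lemma contravector_w : contravector w.
Proof.
have [uw up wu wp] := Huw; have [uc ua pc pa] := Hwc.
move=> j k l; rewrite /glE !expand (lie_pairl _ _ _ Hw).
by rewrite !lie_mul0 ?sub0r ?addr0 //; exact: commutingC.
Qed.

Lemma covector_pw : covector pw.
Proof.
have [uw up wu wp] := Huw; have [uc ua pc pa] := Hwc.
move=> j k l; rewrite /glE !expand (lie_pairr _ _ _ Hw).
by rewrite !lie_mul0 ?sub0r ?opprK ?addr0 //; exact: commutingC.
Qed.

Lemma covector_c : covector c.
Proof.
have [uc ua pc pa] := Huc; have [wc wa qc qa] := Hwc.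
move=> j k l; rewrite /glE !expand (lie_pairl _ _ _ Hc).
by rewrite !lie_mul0 ?subr0 ?add0r //; exact: commutingC.
Qed.

Lemma contravector_a : contravector a.
Proof.
have [uc ua pc pa] := Huc; have [wc wa qc qa] := Hwc.
move=> j k l; rewrite /glE !expand (lie_pairr _ _ _ Hc).
by rewrite !lie_mul0 ?subr0 ?add0r //; exact: commutingC.
Qed.

(** The bracket with [glE j k] is a derivation, so it is determined on quadratic
    expressions by its effect on the factors. *)
Lemma lie_glE_cocontra v v' j k l m : covector v -> contravector v' ->
  lie (glE j k) (v l * v' m) =
  (k == l)%:R *: (v j * v' m) - (j == m)%:R *: (v l * v' k).
Proof.
by move=> Hv Hv'; rewrite lieMr Hv Hv' mulrN -scalerAl -scalerAr.
Qed.

Lemma lie_glE_contraco v v' j k l m : covector v -> contravector v' ->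
  lie (glE j k) (v' m * v l) =
  (k == l)%:R *: (v' m * v j) - (j == m)%:R *: (v' k * v l).
Proof.
by move=> Hv Hv'; rewrite lieMr Hv Hv' mulNr -scalerAl -scalerAr addrC.
Qed.

(** Each quadratic part of [glE l m] is a product of a covector and a
    contravector. *)
Lemma lie_glE j k l m :
  lie (glE j k) (glE l m) = (k == l)%:R *: glE j m - (j == m)%:R *: glE l k.
Proof.
rewrite {2}/glE !lieDr lieNr.
rewrite (lie_glE_cocontra _ _ _ _ covector_u contravector_pu).
rewrite (lie_glE_contraco _ _ _ _ covector_pw contravector_w).
rewrite (lie_glE_cocontra _ _ _ _ covector_c contravector_a).
rewrite [lie _ _%:A]lieC lie_alg oppr0 addr0.
(* The scalar terms cancel: their coefficients are symmetric in the pairs. *)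
have sE : (k == l)%:R *: (2^-1 * (j == m)%:R)%:A =
    (j == m)%:R *: (2^-1 * (l == k)%:R)%:A :> A.
  by rewrite !scalerA [l == k]eq_sym; congr (_ *: _); ring.
rewrite /glE !scalerDr sE !scalerN [in RHS]opprD [RHS]addrACA subrr addr0.
rewrite [in RHS]opprD [RHS]addrACA; congr (_ + _).
by rewrite !opprB addrACA [RHS]addrACA; congr (_ + _); exact: addrC.
Qed.

(** Only the terms with [l = k] and with [l = j] survive in the sum of the
    brackets, and they cancel. *)
Lemma lie_glE_contraction v v' j k : covector v -> contravector v' ->
  lie (glE j k) (\sum_l v l * v' l) = 0 /\ lie (glE j k) (\sum_l v' l * v l) = 0.
Proof.
move=> Hv Hv'; rewrite !lie_sumr.
under eq_bigr do rewrite lie_glE_cocontra //.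
under [X in _ /\ X = _]eq_bigr do rewrite lie_glE_contraco //.
rewrite !sumrB.
have S (f : 'I_n -> A) i : \sum_l (i == l)%:R *: f l = f i.
  rewrite (bigD1 i) //= eqxx scale1r big1 ?addr0 // => l /negbTE li.
  by rewrite eq_sym li scale0r.
by rewrite !S !subrr.
Qed.

Definition glrho (X : 'M[K]_n) : A := \sum_j \sum_k X j k *: glE j k.

Lemma glrho_lin t X Y : glrho (t *: X + Y) = t *: glrho X + glrho Y.
Proof.
rewrite /glrho scaler_sumr -big_split; apply: eq_bigr => j _ /=.
rewrite scaler_sumr -big_split; apply: eq_bigr => k _ /=.
by rewrite !mxE scalerDl scalerA.
Qed.

Lemma lie_glrho_glE X l m : lie (glrho X) (glE l m) =
  \sum_j X j l *: glE j m - \sum_k X m k *: glE l k.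
Proof.
rewrite lie_suml; under eq_bigr do rewrite lie_suml.
under eq_bigr => j _ do under eq_bigr do rewrite lieZl lie_glE scalerBr.
under eq_bigr do rewrite sumrB; rewrite sumrB; congr (_ - _).
  apply: eq_bigr => j _; rewrite (bigD1 l) //= eqxx scale1r big1 ?addr0 // => k.
  by move=> /negbTE ->; rewrite scale0r scaler0.
rewrite (bigD1 m) //= eqxx [X in _ + X]big1 ?addr0 => [|j /negbTE ->].
  by apply: eq_bigr => k _; rewrite scale1r.
by rewrite big1 // => k _; rewrite scale0r scaler0.
Qed.

Lemma glrho_lie X Y : glrho (X *m Y - Y *m X) = lie (glrho X) (glrho Y).
Proof.
rewrite addrC -scaleN1r glrho_lin scaleN1r.
rewrite [RHS]lie_sumr; under [RHS]eq_bigr do rewrite lie_sumr.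
under [RHS]eq_bigr => l _ do
  under eq_bigr do rewrite lieZr lie_glrho_glE scalerBr.
under [RHS]eq_bigr do rewrite sumrB; rewrite sumrB addrC; congr (_ - _).
  rewrite /glrho.
  under eq_bigr => j _ do under eq_bigr => m _ do rewrite mxE scaler_suml.
  under [RHS]eq_bigr => l _ do under eq_bigr => m _ do rewrite scaler_sumr.
  under eq_bigr do rewrite exchange_big; rewrite exchange_big /=.
  apply: eq_bigr => l _; rewrite exchange_big; apply: eq_bigr => m _ /=.
  by apply: eq_bigr => j _; rewrite scalerA mulrC.
apply: eq_bigr => l _.
under eq_bigr => k _ do rewrite mxE scaler_suml.
under [RHS]eq_bigr => m _ do rewrite scaler_sumr.
rewrite exchange_big; apply: eq_bigr => m _ /=.
by apply: eq_bigr => k _; rewrite scalerA.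
Qed.

(** This recovers the entries of [X] from [glrho X] as soon as the [u j] are
    linearly independent. *)
Lemma lie_glrho_u X l : lie (glrho X) (u l) = \sum_j X j l *: u j.
Proof.
rewrite lie_suml; apply: eq_bigr => j _.
rewrite lie_suml (bigD1 l) //= lieZl covector_u eqxx scale1r big1 ?addr0 // => k.
by move=> /negbTE kl; rewrite lieZl covector_u kl scale0r scaler0.
Qed.

End GlAction.

(** * Complex coordinates in the Weyl algebra *)

Section ComplexCoordinates.
Variables (K : fieldType) (I : K) (A : algType K) (n : nat).
Hypotheses (I2 : I * I = -1) (two_neq0 : 2 != 0 :> K).
Variables (z p : 'I_(n + n) -> A) (q d : 'I_n -> A).

(** The coordinates of R^2n and their partial derivatives form single families
    [z], [p]: the relations do not distinguish x from y. *)
Record weyl_rel : Prop := WeylRel {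
  lie_zz : forall a b, lie (z a) (z b) = 0;
  lie_pp : forall a b, lie (p a) (p b) = 0;
  lie_pz : forall a b, lie (p a) (z b) = (a == b)%:R;
  lie_qq : forall j k, lie (q j) (q k) = 0;
  lie_dd : forall j k, lie (d j) (d k) = 0;
  lie_dq : forall j k, lie (d j) (q k) = (j == k)%:R;
  lie_zq : forall a j, lie (z a) (q j) = 0;
  lie_zd : forall a j, lie (z a) (d j) = 0;
  lie_pq : forall a j, lie (p a) (q j) = 0;
  lie_pd : forall a j, lie (p a) (d j) = 0 }.

Hypothesis W : weyl_rel.

Let x j := z (lshift n j).
Let y j := z (rshift n j).
Let px j := p (lshift n j).
Let py j := p (rshift n j).

(** Every element is written with both coefficients, so that the product rule
    [mulr_lin2] applies to all of them alike. *)
Definition zeta j := 1 *: x j + (- I) *: y j.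
Definition dzeta j := 2^-1 *: px j + (I / 2) *: py j.
Definition zetab j := 1 *: x j + I *: y j.
Definition dzetab j := 2^-1 *: px j + (- (I / 2)) *: py j.

(** Instead of dividing both by the square root of 2, the factor 1/2 is put in
    one of them; the commutator of [annih j] with [create j] is still 1. *)
Definition create j := 2^-1 *: q j + (- 2^-1) *: d j.
Definition annih j := 1 *: q j + 1 *: d j.

Let lie_zp a b : lie (z a) (p b) = - (a == b)%:R.
Proof. by rewrite lieC (lie_pz W) eq_sym. Qed.

Let lie_qd j k : lie (q j) (d k) = - (j == k)%:R.
Proof. by rewrite lieC (lie_dq W) eq_sym. Qed.

Let scal_eq0 (k : K) (m : A) : k = 0 -> k *: m = 0.
Proof. by move=> ->; rewrite scale0r. Qed.

Let lieE := (lie_zz W, lie_pp W, lie_pz W, lie_zp,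
  (lie_qq W, lie_dd W, lie_dq W, lie_qd), (lie_zq W, lie_zd W, lie_pq W, lie_pd W),
  eq_lshift, eq_rshift, eq_lrshift, eq_rlshift).

Let zeroE := (mulr0n, oppr0, scaler0, addr0, add0r).

Lemma pair_zeta : pair_at zeta dzeta.
Proof.
split=> j k; rewrite !(lieDl, lieDr, lieZl, lieZr) !lieE ?zeroE //.
rewrite !scalerA -scalerDl -[RHS]scale1r; congr (_ *: _); field: I2.
exact: two_neq0.
Qed.

Lemma pair_zetab : pair_at zetab dzetab.
Proof.
split=> j k; rewrite !(lieDl, lieDr, lieZl, lieZr) !lieE ?zeroE //.
rewrite !scalerA -scalerDl -[RHS]scale1r; congr (_ *: _); field: I2.
exact: two_neq0.
Qed.

Lemma pair_create : pair_at create annih.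
Proof.
split=> j k; rewrite !(lieDl, lieDr, lieZl, lieZr) !lieE ?zeroE
  ?scalerN -?scaleNr ?scalerA -?scalerDl [j == k]eq_sym //.
- by apply: scal_eq0; ring.
- by apply: scal_eq0; ring.
- by rewrite -[RHS]scale1r; congr (_ *: _); field.
Qed.

Lemma indep_zeta_zetab : independent zeta dzeta zetab dzetab.
Proof.
split=> j k; rewrite !(lieDl, lieDr, lieZl, lieZr) !lieE ?zeroE
  ?scalerN -?scaleNr ?scalerA -?scalerDl ?zeroE //.
- by apply: scal_eq0; field: I2.
- by apply: scal_eq0; field: I2.
Qed.

Lemma indep_zeta_create : independent zeta dzeta create annih.
Proof. by split=> j k; rewrite !(lieDl, lieDr, lieZl, lieZr) !lieE ?zeroE. Qed.

Lemma indep_zetab_create : independent zetab dzetab create annih.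
Proof. by split=> j k; rewrite !(lieDl, lieDr, lieZl, lieZr) !lieE ?zeroE. Qed.

Definition weylE := glE zeta dzeta zetab dzetab create annih.

Lemma weylE_real j k : weylE j k = 2^-1 *:
  ((x j * px k + y j * py k + I *: (x j * py k - y j * px k))
  - (x k * px j + y k * py j - I *: (x k * py j - y k * px j))
  + (q j * d k - q k * d j + (q j * q k - d j * d k))).
Proof.
rewrite /weylE /glE 2!(scalerDr 2^-1) scalerN -[LHS]addrA.
rewrite !mulr_lin2; congr (_ - _ + _).
- rewrite !scalerDr !scalerN -!scaleNr !scalerA [RHS]addrAC [in RHS]addrA.
  by congr (_ *: _ + _ *: _ + _ *: _ + _ *: _); field: I2.
- rewrite -[in RHS]scaleNr !scalerDr !scalerN -!scaleNr !scalerA.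
  rewrite [RHS]addrAC [in RHS]addrA.
  by congr (_ *: _ + _ *: _ + _ *: _ + _ *: _); field: I2.
have -> : d j * q k = q k * d j + (j == k)%:R.
  by rewrite -(lie_dq W) /lie addrC subrK.
rewrite !scalerDr !scalerN -!scaleNr !mulr1 mulr_natr -!addrA.
have -> : (2^-1 *+ (j == k))%:A = 2^-1 *: (j == k)%:R :> A by rewrite -scalerMnl scalerMnr.
rewrite [_ *: (d j * d k) + _]addrC [- 2^-1 *: (j == k)%:R]scaleNr addKr.
by rewrite [LHS]addrCA; congr (_ + _); exact: addrCA.
Qed.

Let collect4 (k1 k2 k3 k4 l1 l2 l3 l4 s t : K) (m1 m2 m3 m4 : A) :
  s *: (k1 *: m1 + k2 *: m2 + k3 *: m3 + k4 *: m4)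
  + t *: (l1 *: m1 + l2 *: m2 + l3 *: m3 + l4 *: m4) =
  (s * k1 + t * l1) *: m1 + (s * k2 + t * l2) *: m2
  + (s * k3 + t * l3) *: m3 + (s * k4 + t * l4) *: m4.
Proof.
rewrite !scalerDr !scalerA !scalerDl.
by rewrite addrACA [X in X + _]addrACA [X in X + _ + _]addrACA.
Qed.

(** Both Dirac operators are combinations of the same two contractions of a
    covector with a contravector. *)
Lemma Ds_complex : \sum_j (I *: (q j * py j) - d j * px j) =
  2 *: \sum_j create j * dzeta j - \sum_j annih j * dzetab j.
Proof.
rewrite scaler_sumr -sumrB; apply: eq_bigr => j _.
rewrite -[X in _ = _ + X]scaleN1r !mulr_lin2 collect4.
transitivity (0 *: (q j * px j) + I *: (q j * py j) + (-1) *: (d j * px j)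
  + 0 *: (d j * py j)); first by rewrite !scale0r add0r addr0 scaleN1r.
by congr (_ *: _ + _ *: _ + _ *: _ + _ *: _); field: I2.
Qed.

Lemma Dt_complex : \sum_j (I *: (q j * px j) + py j * d j) =
  (2 * I) *: (\sum_j create j * dzeta j) + I *: \sum_j annih j * dzetab j.
Proof.
rewrite !scaler_sumr -big_split; apply: eq_bigr => j _ /=.
have -> : py j * d j = d j * py j by apply/eqP; rewrite -subr_eq0 -/(lie _ _) (lie_pd W).
rewrite !mulr_lin2 collect4.
transitivity (I *: (q j * px j) + 0 *: (q j * py j) + 0 *: (d j * px j)
  + 1 *: (d j * py j)); first by rewrite !scale0r !addr0 scale1r.
by congr (_ *: _ + _ *: _ + _ *: _ + _ *: _); field: I2.
Qed.

End ComplexCoordinates.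

(** * Operators on the tensor product *)

Section TensorOperators.
Variables (K : fieldType) (X Y : Type).
Variables (P : set (X -> K)) (S : set (Y -> K)).
Hypotheses (subP : is_subspace P) (subS : is_subspace S).

(** Operators are total maps on functions, but partial derivatives are linear
    only on differentiable functions; hence the restriction to [Q]. *)
Definition linear_on (Z : Type) (Q : set (Z -> K)) (phi : (Z -> K) -> (Z -> K)) : Prop :=
  (forall f, Q f -> Q (phi f)) /\
  (forall a f g, Q f -> Q g ->
     phi (fun x => a * f x + g x) = fun x => a * phi f x + phi g x).

Lemma linear_on_sum (Z : Type) (Q : set (Z -> K)) phi m
    (c : 'I_m -> K) (f : 'I_m -> Z -> K) :
  is_subspace Q -> linear_on Q phi -> (forall k, Q (f k)) ->
  Q (fun x => \sum_(k < m) c k * f k x) /\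
  phi (fun x => \sum_(k < m) c k * f k x) = fun x => \sum_(k < m) c k * phi (f k) x.
Proof.
move=> [Q0 QL] [phiQ phiL] Qf; elim: m c f Qf => [|m IH] c f Qf.
  have E (g : 'I_0 -> Z -> K) : (fun x => \sum_(k < 0) c k * g k x) = fun=> 0.
    by apply/funext => x; rewrite big_ord0.
  rewrite !E; split=> //; have := phiL (- 1) _ _ Q0 Q0.
  rewrite (_ : (fun _ => _) = (fun=> 0)) => [->|]; apply/funext => x.
    by rewrite mulN1r addNr.
  by rewrite mulr0 addr0.
have [IQ IE] := IH (c \o lift ord0) (f \o lift ord0) (fun k => Qf _).
have E (g : 'I_m.+1 -> Z -> K) : (fun x => \sum_(k < m.+1) c k * g k x) =
    fun x => c ord0 * g ord0 x + \sum_(k < m) (c \o lift ord0) k * (g \o lift ord0) k x.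
  by apply/funext => x; rewrite big_ord_recl.
by rewrite !E; split; [exact: QL|rewrite phiL // IE].
Qed.

Lemma tensor_lin a F G : tensor P S F -> tensor P S G ->
  tensor P S (fun x y => a * F x y + G x y).
Proof.
move=> [m [p [f [Pp Sf ->]]]] [m' [p' [f' [Pp' Sf' ->]]]].
exists (m + m')%N,
  (fun k : 'I_(m + m') => match fintype.split k with
            | inl i => fun x => a * p i x + 0 | inr j => p' j end),
  (fun k => match fintype.split k with inl i => f i | inr j => f' j end).
split=> [k|k|].
- by case: fintype.split => // i; apply: subP.2 => //; exact: subP.1.
- by case: fintype.split.
apply/funext => x; apply/funext => y; rewrite big_split_ord mulr_sumr.
congr (_ + _); apply: eq_bigr => k _.
  by rewrite (unsplitK (inl k)) addr0 mulrA.
by rewrite (unsplitK (inr k)).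
Qed.

Lemma tensor_cols F y : tensor P S F -> P (fun x => F x y).
Proof.
move=> [m [p [f [Pp Sf ->]]]].
have idP : linear_on P id by [].
have [+ _] := linear_on_sum (fun k => f k y) subP idP Pp.
by congr P; apply/funext => x; apply: eq_bigr => k _; rewrite mulrC.
Qed.

Lemma tensor_rows F x : tensor P S F -> S (F x).
Proof.
move=> [m [p [f [Pp Sf ->]]]].
have idS : linear_on S id by [].
by have [] := linear_on_sum (fun k => p k x) subS idS Sf.
Qed.

(** [lft phi] and [rgt psi] realise phi (x) 1 and 1 (x) psi. *)
Definition lft (phi : (X -> K) -> (X -> K)) (F : X -> Y -> K) : X -> Y -> K :=
  fun x y => phi (fun x' => F x' y) x.

Definition rgt (psi : (Y -> K) -> (Y -> K)) (F : X -> Y -> K) : X -> Y -> K :=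
  fun x y => psi (F x) y.

Lemma lft_sum phi m (p : 'I_m -> X -> K) (f : 'I_m -> Y -> K) :
  linear_on P phi -> (forall k, P (p k)) ->
  lft phi (fun x y => \sum_(k < m) p k x * f k y) =
  fun x y => \sum_(k < m) phi (p k) x * f k y.
Proof.
move=> Lphi Pp; apply/funext => x; apply/funext => y; rewrite /lft.
have [_ E] := linear_on_sum (fun k => f k y) subP Lphi Pp.
under eq_bigr do rewrite mulrC; rewrite -[RHS](congr1 (@^~ x) E).
by congr (phi _ x); apply/funext => x'; apply: eq_bigr => k _; rewrite mulrC.
Qed.

Lemma rgt_sum psi m (p : 'I_m -> X -> K) (f : 'I_m -> Y -> K) :
  linear_on S psi -> (forall k, S (f k)) ->
  rgt psi (fun x y => \sum_(k < m) p k x * f k y) =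
  fun x y => \sum_(k < m) p k x * psi (f k) y.
Proof.
move=> Lpsi Sf; apply/funext => x; rewrite /rgt.
by have [_ ->] := linear_on_sum (fun k => p k x) subS Lpsi Sf.
Qed.

Lemma linear_on_lft phi : linear_on P phi ->
  (forall F, tensor P S F -> tensor P S (lft phi F)) /\
  forall a F G, tensor P S F -> tensor P S G ->
    lft phi (fun x y => a * F x y + G x y) =
    fun x y => a * lft phi F x y + lft phi G x y.
Proof.
move=> Lphi; split=> [_ [m [p [f [Pp Sf ->]]]]|a F G TF TG].
  exists m, (phi \o p), f; split=> //; first by move=> k; exact: Lphi.1.
  exact: lft_sum.
apply/funext => x; apply/funext => y; rewrite /lft.
by rewrite (Lphi.2 a _ _ (tensor_cols y TF) (tensor_cols y TG)).
Qed.

Lemma linear_on_rgt psi : linear_on S psi ->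
  (forall F, tensor P S F -> tensor P S (rgt psi F)) /\
  forall a F G, tensor P S F -> tensor P S G ->
    rgt psi (fun x y => a * F x y + G x y) =
    fun x y => a * rgt psi F x y + rgt psi G x y.
Proof.
move=> Lpsi; split=> [_ [m [p [f [Pp Sf ->]]]]|a F G TF TG].
  exists m, p, (psi \o f); split=> //; first by move=> k; exact: Lpsi.1.
  exact: rgt_sum.
apply/funext => x; rewrite /rgt.
exact: (Lpsi.2 a _ _ (tensor_rows x TF) (tensor_rows x TG)).
Qed.

Lemma lft_rgtC phi psi F : linear_on P phi -> linear_on S psi -> tensor P S F ->
  lft phi (rgt psi F) = rgt psi (lft phi F).
Proof.
move=> Lphi Lpsi [m [p [f [Pp Sf ->]]]].
rewrite rgt_sum // lft_sum // lft_sum // [RHS](rgt_sum (phi \o p)) //.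
Qed.

End TensorOperators.

Section Endomorphisms.
Variables (R : realType) (n : nat).
Local Notation field := (spinor_field R n).

Definition polyspinor_pred : {pred field} := fun F => `[< polyspinors F >].

Lemma polyspinor_predP : GRing.subsemimod_closed polyspinor_pred.
Proof.
have T := tensor_lin (S := schwartz R n) (polyfun_subspace R (n + n)).
have T0 : polyspinors (0 : field).
  exists 0%N, (fun=> fun=> 0), (fun=> fun=> 0); split; [by case|by case|].
  by apply/funext => z; apply/funext => q; rewrite big_ord0.
split; first split; rewrite /polyspinor_pred.
- exact/asboolP.
- move=> F G /asboolP TF /asboolP TG; apply/asboolP.
  have := T 1 F G TF TG; congr polyspinors.
  by apply/funext => z; apply/funext => q; rewrite mul1r.
- move=> a F /asboolP TF; apply/asboolP.
  have := T a F 0 TF T0; congr polyspinors.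
  by apply/funext => z; apply/funext => q; rewrite addr0.
Qed.

(** A type of polynomial spinors is needed for operators to form an algebra:
    operators on all functions agree with the expected relations only on
    [polyspinors]. *)
Record polyspinor := Polyspinor {
  polyspinor_val : field; _ : polyspinor_val \in polyspinor_pred }.

HB.instance Definition _ := [isSub for polyspinor_val].
HB.instance Definition _ := [Choice of polyspinor by <:].
HB.instance Definition _ :=
  GRing.SubChoice_isSubLmodule.Build R[i] field polyspinor_pred polyspinor polyspinor_predP.

Lemma polyspinorP (v : polyspinor) : polyspinors (val v).
Proof. by apply/asboolP; exact: (valP v). Qed.

Definition endo_pred : {pred polyspinor -> polyspinor} := fun D => `[< linear D >].

Lemma endo_predP : GRing.subsemimod_closed endo_pred.
Proof.
split; first split; rewrite /endo_pred.
- by apply/asboolP => a u v; rewrite scaler0 addr0.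
- move=> D E /asboolP LD /asboolP LE; apply/asboolP => a u v.
  by rewrite /= [LHS]/(D _ + E _) LD LE scalerDr addrACA.
- move=> k D /asboolP LD; apply/asboolP => a u v.
  have E w : (k *: D) w = k *: D w by [].
  by rewrite !E LD scalerDr !scalerA mulrC.
Qed.

Record endo := Endo {
  endo_val :> polyspinor -> polyspinor; _ : endo_val \in endo_pred }.

HB.instance Definition _ := [isSub for endo_val].
HB.instance Definition _ := [Choice of endo by <:].
HB.instance Definition _ := GRing.SubChoice_isSubLmodule.Build R[i]
  (polyspinor -> polyspinor) endo_pred endo endo_predP.

Lemma endo_linear (D : endo) : linear D.
Proof. by apply/asboolP; exact: (valP D). Qed.

Lemma endoP (D E : endo) : (forall v, D v = E v) -> D = E.
Proof. by move=> DE; apply/val_inj/funext. Qed.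

Lemma endo_add (D : endo) u v : D (u + v) = D u + D v.
Proof. by rewrite -[u]scale1r endo_linear !scale1r. Qed.

Lemma endo_scale (D : endo) a v : D (a *: v) = a *: D v.
Proof.
have D0 : D 0 = 0 by apply: (addrI (D 0)); rewrite -endo_add !addr0.
by rewrite -[a *: v]addr0 endo_linear D0 !addr0.
Qed.

Fact endo_one_subproof : (id : polyspinor -> polyspinor) \in endo_pred.
Proof. by apply/asboolP. Qed.
Definition endo_one := Endo endo_one_subproof.

Fact endo_mul_subproof (D E : endo) : (D \o E : polyspinor -> polyspinor) \in endo_pred.
Proof. by apply/asboolP => a u v /=; rewrite !endo_linear. Qed.
Definition endo_mul D E := Endo (endo_mul_subproof D E).

Fact endo_mulA : associative endo_mul. Proof. by move=> *; exact: endoP. Qed.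
Fact endo_mul1 : left_id endo_one endo_mul. Proof. by move=> *; exact: endoP. Qed.
Fact endo_1mul : right_id endo_one endo_mul. Proof. by move=> *; exact: endoP. Qed.
Fact endo_mulDl : left_distributive endo_mul +%R.
Proof. by move=> *; exact: endoP. Qed.
Fact endo_mulDr : right_distributive endo_mul +%R.
Proof. by move=> *; apply: endoP => v; exact: endo_add. Qed.

(** The vector 1 (x) Gaussian is the vacuum of the oscillator.  It shows that the
    endomorphism algebra is not zero, and separates the elements of u(n). *)
Fact vacuum_subproof :
  (fun (_ : 'rV[R]_(n + n)) q => gaussian q : R[i]) \in polyspinor_pred.
Proof.
apply/asboolP; exists 1%N, (fun=> fun=> 1), (fun=> @gaussian R n); split=> [_|_|].
- exact: polyfun_cst.
- exact: schwartz_gaussian.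
by apply/funext => z; apply/funext => q; rewrite big_ord1 mul1r.
Qed.
Definition vacuum := Polyspinor vacuum_subproof.

Lemma vacuum0 z : val vacuum z 0 = 1.
Proof. exact: gaussian0. Qed.

Fact endo_one_neq0 : endo_one != 0.
Proof.
apply/eqP => /(congr1 (fun D : endo => D vacuum)) /(congr1 val).
move=> /(congr1 (fun F : field => F 0 0)) /eqP.
by rewrite [_ 0 0]vacuum0 oner_eq0.
Qed.

HB.instance Definition _ := GRing.Zmodule_isNzRing.Build endo
  endo_mulA endo_mul1 endo_1mul endo_mulDl endo_mulDr endo_one_neq0.

Fact endo_scaleAl (a : R[i]) (D E : endo) : a *: (D * E) = (a *: D) * E.
Proof. exact: endoP. Qed.
HB.instance Definition _ := GRing.Lmodule_isLalgebra.Build R[i] endo endo_scaleAl.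

Fact endo_scaleAr (a : R[i]) (D E : endo) : a *: (D * E) = D * (a *: E).
Proof. by apply: endoP => v; rewrite [RHS]endo_scale. Qed.
HB.instance Definition _ := GRing.Lalgebra_isAlgebra.Build R[i] endo endo_scaleAr.

End Endomorphisms.

(** * The representation of u(n) on polynomial spinors *)

Lemma sum_offdiag n (V : nmodType) (f : 'I_n -> 'I_n -> V) :
  \sum_j \sum_k f j k =
  \sum_(j < n) \sum_(k < n | (j < k)%N) (f j k + f k j) + \sum_j f j j.
Proof.
under [in RHS]eq_bigr do rewrite big_split /=; rewrite [in RHS]big_split /=.
rewrite [X in _ + X + _](exchange_big_dep predT) //= -!big_split /=.
apply: eq_bigr => j _; rewrite (bigID (fun k : 'I_n => (j < k)%N)) /= -addrA.
congr (_ + _); rewrite (bigD1 j) ?ltnn //= addrC; congr (_ + _).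
by apply: eq_bigl => k; rewrite -leqNgt ltn_neqAle andbC.
Qed.

(** For a skew-Hermitian matrix the entries [t] at (j, k) and [- t^*] at (k, j)
    contribute the real combination Im t A_jk + Re t C_jk. *)
Lemma skew_pair (R : realType) (V : lmodType R[i]) (t : R[i]) (u w : V) :
  t *: u + (- t^*%C) *: w =
  (complex.Im t)%:C *: ('i%C *: (u + w)) + (complex.Re t)%:C *: (u - w).
Proof.
rewrite scalerA scalerDr [in RHS]scalerBr addrACA -scalerDl -scalerBl.
case: t => r s; congr (_ *: _ + _ *: _); apply/eqP; rewrite eq_complex /=;
  by apply/andP; split; apply/eqP; ring.
Qed.

Lemma skew_diag (R : realType) (V : lmodType R[i]) (t : R[i]) (u : V) :
  t = - t^*%C -> t *: u = (complex.Im t)%:C *: ('i%C *: u).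
Proof.
case: t => r s [rE _]; rewrite /= scalerA; congr (_ *: _).
have -> : r = 0 by lra.
by apply/eqP; rewrite eq_complex /=; apply/andP; split; apply/eqP; ring.
Qed.

Section Representation.
Variables (R : realType) (n : nat).
Local Notation A := (endo R n).
Implicit Types (D E : operator R n) (d e : A) (v : polyspinor R n).

(** [e] is the restriction of [D] to the polynomial spinors. *)
Definition represented D e : Prop := forall v, D (val v) = val (e v).

Lemma polyspinor_surj F : polyspinors F -> exists v : polyspinor R n, F = val v.
Proof. by move=> /asboolP TF; exists (Polyspinor TF). Qed.

Lemma represented_endo D e : represented D e -> is_endo D.
Proof.
move=> De; split=> [F /polyspinor_surj[v ->]|a F G].
  by rewrite De; exact: polyspinorP.
move=> /polyspinor_surj[v ->] /polyspinor_surj[w ->].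
by rewrite -[scale a _ + _]/(val (a *: v + w)) !De endo_linear.
Qed.

Lemma represented_commute D E d e : represented D d -> represented E e ->
  lie e d = 0 -> commute_on D E.
Proof.
move=> Dd Ee /eqP; rewrite subr_eq0 => /eqP ed F /polyspinor_surj[v ->].
by rewrite Ee !Dd Ee -[d (e v)]/((d * e) v) -ed.
Qed.

Fact endo_of_pred D (H : is_endo D) v : D (val v) \in @polyspinor_pred R n.
Proof. by apply/asboolP/H.1/polyspinorP. Qed.

Fact endo_of_subproof D (H : is_endo D) :
  (fun v => Polyspinor (endo_of_pred H v)) \in @endo_pred R n.
Proof.
apply/asboolP => a u v; apply: val_inj.
exact: (H.2 a _ _ (polyspinorP u) (polyspinorP v)).
Qed.

Definition endo_of D (H : is_endo D) : A := Endo (endo_of_subproof H).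

Lemma is_endo_lft phi :
  linear_on (polyfun R (n + n)) phi -> is_endo (lft phi : operator R n).
Proof.
move=> Lphi.
have [T L] := linear_on_lft (schwartz R n) (polyfun_subspace R _) Lphi.
by split=> // a F G TF TG; exact: L.
Qed.

Lemma is_endo_rgt psi :
  linear_on (schwartz R n) psi -> is_endo (rgt psi : operator R n).
Proof.
move=> Lpsi.
have [T L] := linear_on_rgt (polyfun R (n + n)) (schwartz_subspace R _) Lpsi.
by split=> // a F G TF TG; exact: L.
Qed.

Definition coordM m (a : 'I_m) (f : 'rV[R]_m -> R[i]) := fun u => coord a u * f u.

Lemma coordM_lin m (a : 'I_m) c f g : coordM a (fun u => c * f u + g u) =
  fun u => c * coordM a f u + coordM a g u.
Proof. by apply/funext => u; rewrite /coordM; ring. Qed.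

Lemma poly_mul a : linear_on (polyfun R (n + n)) (coordM a).
Proof.
by split=> [p Pp|c p p' _ _]; [exact: polyfun_coordM|exact: coordM_lin].
Qed.

Lemma poly_der a : linear_on (polyfun R (n + n)) (pd a).
Proof.
split=> [p /polyfun_calculus[]|c p p'] //.
move=> /polyfun_calculus[_ dp _] /polyfun_calculus[_ dp' _].
by case: (pd_lin c (dp a) (dp' a)).
Qed.

Lemma schwartz_mul j : linear_on (schwartz R n) (coordM j).
Proof.
by split=> [f Sf|c f g _ _]; [exact: schwartz_coordM|exact: coordM_lin].
Qed.

Lemma schwartz_der j : linear_on (schwartz R n) (pd j).
Proof.
split=> [f|c f g Sf Sg]; first exact: schwartz_pd.
by case: (pd_lin c (schwartz_has_pd j Sf) (schwartz_has_pd j Sg)).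
Qed.

Definition Zmul a : A := endo_of (is_endo_lft (poly_mul a)).
Definition Zder a : A := endo_of (is_endo_lft (poly_der a)).
Definition Qmul j : A := endo_of (is_endo_rgt (schwartz_mul j)).
Definition Qder j : A := endo_of (is_endo_rgt (schwartz_der j)).

Lemma eval_natr (b : bool) v : (b%:R : A) v = b%:R *: v.
Proof. by case: b; [rewrite scale1r|rewrite scale0r]. Qed.

Lemma endo_eval d e : (forall v z q, val (d v) z q = val (e v) z q) -> d = e.
Proof.
move=> H; apply: endoP => v; apply: val_inj.
by apply/funext => z; apply/funext => q.
Qed.

Lemma lie_lft_rgt phi psi (H : linear_on (polyfun R (n + n)) phi)
    (H' : linear_on (schwartz R n) psi) :
  lie (endo_of (is_endo_lft H)) (endo_of (is_endo_rgt H')) = 0.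
Proof.
apply: endoP => v; apply: val_inj.
rewrite -[LHS]/(lft phi (rgt psi (val v)) - rgt psi (lft phi (val v))).
rewrite (lft_rgtC (polyfun_subspace R _) (schwartz_subspace R _) H H' (polyspinorP v)).
by rewrite subrr.
Qed.

(** By [lft_rgtC] only the relations within one tensor factor need calculus;
    these are checked on the slices of a polynomial spinor. *)
Lemma weyl : weyl_rel Zmul Zder Qmul Qder.
Proof.
have cols v q : polyfun R (n + n) (fun z => val v z q).
  exact: (tensor_cols (polyfun_subspace R _) q (polyspinorP v)).
have rows v z : schwartz R n (val v z).
  exact: (tensor_rows (schwartz_subspace R _) z (polyspinorP v)).
have has_col v q a : has_pd a (fun z => val v z q).
  by have [_ +] := polyfun_calculus (cols v q).
have has_row v z j : has_pd j (val v z) by exact: schwartz_has_pd.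
split=> [a b|a b|a b|j k|j k|j k|a j|a j|a j|a j].
- apply: endo_eval => v z q.
  rewrite -[LHS]/(coord a z * (coord b z * val v z q)
    - coord b z * (coord a z * val v z q)).
  by rewrite -[RHS]/0; ring.
- apply: endo_eval => v z q.
  rewrite -[LHS]/(pd a (pd b (fun z => val v z q)) z
    - pd b (pd a (fun z => val v z q)) z).
  by rewrite pdC ?subrr //; exact: polyfun_smooth.
- apply: endo_eval => v z q.
  rewrite eval_natr -[RHS]/((a == b)%:R * val v z q).
  rewrite -[LHS]/(pd a (fun z => coord b z * val v z q) z
    - coord b z * pd a (fun z => val v z q) z).
  by rewrite (pd_coordM b (has_col v q a)).2 addrK.
- apply: endo_eval => v z q.
  rewrite -[LHS]/(coord j q * (coord k q * val v z q)
    - coord k q * (coord j q * val v z q)).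
  by rewrite -[RHS]/0; ring.
- apply: endo_eval => v z q.
  rewrite -[LHS]/(pd j (pd k (val v z)) q - pd k (pd j (val v z)) q).
  by rewrite pdC ?subrr //; exact: schwartz_smooth.
- apply: endo_eval => v z q.
  rewrite eval_natr -[RHS]/((j == k)%:R * val v z q).
  rewrite -[LHS]/(pd j (fun q => coord k q * val v z q) q
    - coord k q * pd j (val v z) q).
  by rewrite (pd_coordM k (has_row v z j)).2 addrK.
- exact: lie_lft_rgt.
- exact: lie_lft_rgt.
- exact: lie_lft_rgt.
- exact: lie_lft_rgt.
Qed.

Let I2 : 'i%C * 'i%C = -1 :> R[i].
Proof. by rewrite -expr2 sqr_i. Qed.

Let two_neq0 : 2 != 0 :> R[i].
Proof. by rewrite pnatr_eq0. Qed.

Definition spinorE (j k : 'I_n) : A := weylE 'i%C Zmul Zder Qmul Qder j k.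

Definition eval v z q e : R[i] := val (e v) z q.

Lemma evalD v z q d e : eval v z q (d + e) = eval v z q d + eval v z q e.
Proof. by []. Qed.
Lemma evalN v z q e : eval v z q (- e) = - eval v z q e.
Proof. by []. Qed.
Lemma evalZ v z q a e : eval v z q (a *: e) = a * eval v z q e.
Proof. by []. Qed.
Lemma eval_sum v z q I (r : seq I) P (e : I -> A) :
  eval v z q (\sum_(i <- r | P i) e i) = \sum_(i <- r | P i) eval v z q (e i).
Proof. exact: (big_morph (eval v z q) (evalD v z q) (erefl _)). Qed.

Definition eval_lin := (evalD, evalN, evalZ, eval_sum).

Lemma eval_Zmul v z q a e : eval v z q (Zmul a * e) = coord a z * eval v z q e.
Proof. by []. Qed.
Lemma eval_Qmul v z q j e : eval v z q (Qmul j * e) = qc j q * eval v z q e.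
Proof. by []. Qed.
Lemma eval_dx v z q j : eval v z q (Zder (lshift n j)) = dx j (val v) z q.
Proof. by []. Qed.
Lemma eval_dy v z q j : eval v z q (Zder (rshift n j)) = dy j (val v) z q.
Proof. by []. Qed.
Lemma eval_dq v z q j : eval v z q (Qder j) = dq j (val v) z q.
Proof. by []. Qed.
Lemma eval_dqdq v z q j k :
  eval v z q (Qder j * Qder k) = dq j (dq k (val v)) z q.
Proof. by []. Qed.
Lemma eval_dqdx v z q j :
  eval v z q (Qder j * Zder (lshift n j)) = dq j (dx j (val v)) z q.
Proof. by []. Qed.
Lemma eval_dydq v z q j :
  eval v z q (Zder (rshift n j) * Qder j) = dy j (dq j (val v)) z q.
Proof. by []. Qed.
Lemma eval_qq v z q j k :
  eval v z q (Qmul j * Qmul k) = qc j q * (qc k q * val v z q).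
Proof. by []. Qed.
Lemma coord_x j (z : 'rV[R]_(n + n)) : coord (lshift n j) z = xc j z.
Proof. by []. Qed.
Lemma coord_y j (z : 'rV[R]_(n + n)) : coord (rshift n j) z = yc j z.
Proof. by []. Qed.

Lemma eval_zeta v z q j :
  eval v z q (zeta 'i%C Zmul j) = (xc j z - 'i%C * yc j z) * val v z q.
Proof.
rewrite !eval_lin -[Zmul (lshift n j)]mulr1 -[Zmul (rshift n j)]mulr1.
by rewrite !eval_Zmul mul1r mulrBl mulNr mulrA.
Qed.

Lemma represented_eval D e :
  (forall v z q, D (val v) z q = eval v z q e) -> represented D e.
Proof. by move=> H v; apply/funext => z; apply/funext => q; exact: H. Qed.

(* From here on these operators are used through the evaluation rules only. *)
Opaque Zmul Zder Qmul Qder eval.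

Definition evalE := (eval_qq, eval_dqdq, eval_Zmul, eval_Qmul, eval_dx, eval_dy, eval_dq,
  coord_x, coord_y).

Lemma dqC j k v z q : dq k (dq j (val v)) z q = dq j (dq k (val v)) z q.
Proof.
rewrite -!eval_dqdq; congr eval; apply/eqP.
by rewrite -subr_eq0 -/(lie _ _) (lie_dd weyl).
Qed.

(** [spinorE j k] in real coordinates, as an operator on all functions. *)
Definition spinorE_op (j k : 'I_n) : operator R n := fun F z q => 2^-1 *
  (xc j z * dx k F z q + yc j z * dy k F z q
   + 'i%C * (xc j z * dy k F z q - yc j z * dx k F z q)
   - (xc k z * dx j F z q + yc k z * dy j F z q
      - 'i%C * (xc k z * dy j F z q - yc k z * dx j F z q))
   + (qc j q * dq k F z q - qc k q * dq j F z q
      + (qc j q * (qc k q * F z q) - dq j (dq k F) z q))).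

Lemma eval_spinorE v z q j k :
  eval v z q (spinorE j k) = spinorE_op j k (val v) z q.
Proof. by rewrite /spinorE (weylE_real I2 two_neq0 weyl) !eval_lin !evalE. Qed.

Lemma represented_spinorE_op j k : represented (spinorE_op j k) (spinorE j k).
Proof. by apply: represented_eval => v z q; rewrite eval_spinorE. Qed.

Lemma represented_A j k :
  represented (opA j k) ('i%C *: (spinorE j k + spinorE k j)).
Proof.
apply: represented_eval => v z q; rewrite evalZ evalD !eval_spinorE.
rewrite /opA /spinorE_op (dqC j k).
move: (xc j z) (xc k z) (yc j z) (yc k z) (qc j q) (qc k q) (val v z q)
  (dx j (val v) z q) (dx k (val v) z q) (dy j (val v) z q) (dy k (val v) z q)
  (dq j (val v) z q) (dq k (val v) z q) (dq j (dq k (val v)) z q) => *.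
by field: I2.
Qed.

Lemma represented_B j : represented (opB j) ('i%C *: spinorE j j).
Proof.
apply: represented_eval => v z q; rewrite evalZ eval_spinorE.
rewrite /opB /spinorE_op.
move: (xc j z) (yc j z) (qc j q) (val v z q) (dx j (val v) z q)
  (dy j (val v) z q) (dq j (val v) z q) (dq j (dq j (val v)) z q) => *.
by field: I2.
Qed.

Lemma represented_C j k : represented (opC j k) (spinorE j k - spinorE k j).
Proof.
apply: represented_eval => v z q; rewrite evalD evalN !eval_spinorE.
rewrite /opC /spinorE_op (dqC j k).
move: (xc j z) (xc k z) (yc j z) (yc k z) (qc j q) (qc k q) (val v z q)
  (dx j (val v) z q) (dx k (val v) z q) (dy j (val v) z q) (dy k (val v) z q)
  (dq j (val v) z q) (dq k (val v) z q) (dq j (dq k (val v)) z q) => *.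
by field: I2.
Qed.

Definition Ds_endo : A :=
  \sum_j ('i%C *: (Qmul j * Zder (rshift n j)) - Qder j * Zder (lshift n j)).

Definition Dt_endo : A :=
  \sum_j ('i%C *: (Qmul j * Zder (lshift n j)) + Zder (rshift n j) * Qder j).

Lemma represented_Ds : represented (@Ds R n) Ds_endo.
Proof.
apply: represented_eval => v z q; rewrite eval_sum; apply: eq_bigr => j _.
by rewrite evalD evalN evalZ eval_Qmul eval_dy eval_dqdx mulrA.
Qed.

Lemma represented_Dt : represented (@Dt R n) Dt_endo.
Proof.
apply: represented_eval => v z q; rewrite eval_sum; apply: eq_bigr => j _.
by rewrite evalD evalZ eval_Qmul eval_dx eval_dydq mulrA.
Qed.

Let pair_z := pair_zeta I2 two_neq0 weyl.
Let pair_zb := pair_zetab I2 two_neq0 weyl.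
Let pair_q := pair_create two_neq0 weyl.
Let indep_z_zb := indep_zeta_zetab I2 two_neq0 weyl.
Let indep_z_q := indep_zeta_create 'i%C weyl.
Let indep_zb_q := indep_zetab_create 'i%C weyl.

(** Invariance passes to linear combinations, so it needs to be proved for the
    images of the elementary matrices only. *)
Definition invariant e : Prop := lie e Ds_endo = 0 /\ lie e Dt_endo = 0.

Lemma invariantD d e : invariant d -> invariant e -> invariant (d + e).
Proof.
by move=> [ds dt] [es et]; split; rewrite lieDl ?ds ?es ?dt ?et addr0.
Qed.

Lemma invariantZ a e : invariant e -> invariant (a *: e).
Proof. by move=> [es et]; split; rewrite lieZl ?es ?et scaler0. Qed.

Lemma invariant_sum (I : Type) (r : seq I) (P : pred I) (e : I -> A) :
  (forall i, invariant (e i)) -> invariant (\sum_(i <- r | P i) e i).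
Proof.
move=> inv_e; split; rewrite lie_suml big1 // => i _.
  by have [] := inv_e i.
by have [] := inv_e i.
Qed.

Lemma invariant_spinorE j k : invariant (spinorE j k).
Proof.
have H1 : lie (spinorE j k) (\sum_l create Qmul Qder l * dzeta 'i%C Zder l) = 0.
  exact: (lie_glE_contraction j k (covector_c pair_q indep_z_q indep_zb_q)
    (contravector_pu pair_z indep_z_zb indep_z_q)).1.
have H2 : lie (spinorE j k) (\sum_l annih Qmul Qder l * dzetab 'i%C Zder l) = 0.
  exact: (lie_glE_contraction j k (covector_pw pair_zb indep_z_zb indep_zb_q)
    (contravector_a pair_q indep_z_q indep_zb_q)).2.
rewrite /invariant /Ds_endo (Ds_complex I2 two_neq0) /Dt_endo (Dt_complex I2 two_neq0 weyl).
by rewrite !(lieDr, lieNr, lieZr) H1 H2 !scaler0 subrr addr0.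
Qed.

Definition urep (X : 'M[R[i]]_n) : operator R n :=
  fun F => \sum_j \sum_k scale (X j k) (spinorE_op j k F).

Definition urep_endo : 'M[R[i]]_n -> A :=
  glrho (zeta 'i%C Zmul) (dzeta 'i%C Zder) (zetab 'i%C Zmul) (dzetab 'i%C Zder)
    (create Qmul Qder) (annih Qmul Qder).

Lemma urep_endoE X : urep_endo X = \sum_j \sum_k X j k *: spinorE j k.
Proof. by []. Qed.

Lemma represented_sum (I : Type) (r : seq I) (P : pred I)
    (D : I -> operator R n) (e : I -> A) :
  (forall i, represented (D i) (e i)) ->
  represented (fun F => \sum_(i <- r | P i) D i F) (\sum_(i <- r | P i) e i).
Proof.
move=> De; apply: represented_eval => v z q; rewrite eval_sum !fct_sumE.
by apply: eq_bigr => i _; rewrite De.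
Qed.

Lemma represented_scale a D e : represented D e ->
  represented (fun F => scale a (D F)) (a *: e).
Proof. by move=> De; apply: represented_eval => v z q; rewrite De. Qed.

Lemma represented_add D E d e : represented D d -> represented E e ->
  represented (fun F => D F + E F) (d + e).
Proof. by move=> Dd Ee v; rewrite Dd Ee. Qed.

Lemma represented_urep X : represented (urep X) (urep_endo X).
Proof.
rewrite urep_endoE; do 2!(apply: represented_sum => ?).
exact/represented_scale/represented_spinorE_op.
Qed.

Lemma represented_inj D E d e : represented D d -> represented E e ->
  eq_op_on D E -> d = e.
Proof.
move=> Dd Ee DE; apply: endoP => v; apply: val_inj.
by rewrite -Dd -Ee; apply: DE; exact: polyspinorP.
Qed.

(** If [X] and [Y] have the same image, so that the image of [X - Y] is zero,
    then its bracket with [zeta l], which is the sum of the (X - Y)_jl zeta_j,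
    is zero.  On the vacuum at the point with x_j = 1, all other coordinates 0
    and q = 0, that sum takes the value (X - Y)_jl. *)
Lemma urep_endo_inj : injective urep_endo.
Proof.
move=> X Y XY; apply/matrixP => j l; apply/eqP; rewrite -subr_eq0.
have : urep_endo (-1 *: Y + X) = 0.
  by rewrite [LHS]glrho_lin scaleN1r -/urep_endo XY addNr.
move=> W0; have := lie_glrho_u pair_z indep_z_zb indep_z_q (-1 *: Y + X) l.
rewrite -/urep_endo W0 /lie mul0r mulr0 subrr => /esym.
move/(congr1 (eval (vacuum R n) (delta_mx 0 (lshift n j)) 0)).
rewrite eval_sum (bigD1 j) //= big1 => [|k kj].
  rewrite evalZ eval_zeta vacuum0 /xc /yc !mxE /= !eqxx eq_rlshift /=.
  rewrite mulr0 subr0 !mulr1 addr0 mulN1r addrC => ->.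
  by rewrite -[eval _ _ _ 0]/0.
rewrite evalZ eval_zeta /xc /yc !mxE /= eq_lshift (negbTE kj) eq_rlshift /=.
by rewrite mulr0 subrr mul0r mulr0.
Qed.

(** The two readings of a real combination of the A, B and C: as an operator on
    functions and as an element of the endomorphism algebra. *)
Definition span_op (a c : 'I_n -> 'I_n -> R) (b : 'I_n -> R) : operator R n := fun F =>
  \sum_(j < n) \sum_(k < n | (j < k)%N) scale (a j k)%:C (opA j k F)
  + \sum_(j < n) scale (b j)%:C (opB j F)
  + \sum_(j < n) \sum_(k < n | (j < k)%N) scale (c j k)%:C (opC j k F).

Definition span_endo (a c : 'I_n -> 'I_n -> R) (b : 'I_n -> R) : A :=
  \sum_(j < n) \sum_(k < n | (j < k)%N)
    (a j k)%:C *: ('i%C *: (spinorE j k + spinorE k j))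
  + \sum_j (b j)%:C *: ('i%C *: spinorE j j)
  + \sum_(j < n) \sum_(k < n | (j < k)%N) (c j k)%:C *: (spinorE j k - spinorE k j).

Lemma represented_span a c b : represented (span_op a c b) (span_endo a c b).
Proof.
apply: represented_add; first apply: represented_add.
- do 2!(apply: represented_sum => ?); exact/represented_scale/represented_A.
- by apply: represented_sum => ?; exact/represented_scale/represented_B.
- do 2!(apply: represented_sum => ?); exact/represented_scale/represented_C.
Qed.

Lemma in_uP (X : 'M[R[i]]_n) : in_u X <-> forall j k, X k j = - (X j k)^*%C.
Proof.
rewrite /in_u; split=> [XX j k|XX].
  by move/matrixP/(_ k j): XX; rewrite !mxE => ->; rewrite opprK.
by apply/matrixP => j k; rewrite !mxE (XX k j) opprK.
Qed.

Lemma urep_endo_span X : in_u X -> urep_endo X =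
  span_endo (fun j k => complex.Im (X j k)) (fun j k => complex.Re (X j k))
    (fun j => complex.Im (X j j)).
Proof.
move=> /in_uP XX; rewrite urep_endoE sum_offdiag /span_endo.
rewrite [RHS]addrAC -[X in _ = X + _]big_split /=.
congr (_ + _); apply: eq_bigr => j _.
  by rewrite -big_split; apply: eq_bigr => k _; rewrite (XX j k) skew_pair.
exact: skew_diag.
Qed.

(** The skew-Hermitian matrix with coefficients [a], [c], [b] on A, C, B. *)
Definition umatrix (a c : 'I_n -> 'I_n -> R) (b : 'I_n -> R) : 'M[R[i]]_n :=
  \matrix_(j, k) if (j < k)%N then c j k +i* a j k
    else if (k < j)%N then - c k j +i* a k j else 0 +i* b j.

Lemma umatrix_in_u a c b : in_u (umatrix a c b).
Proof.
apply/in_uP => j k; rewrite !mxE; case: ltngtP => [jk|kj|/val_inj ->].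
- by apply/eqP; rewrite eq_complex /= !opprK !eqxx.
- by apply/eqP; rewrite eq_complex /= !opprK !eqxx.
- by apply/eqP; rewrite eq_complex /= !opprK oppr0 !eqxx.
Qed.

Lemma urep_endo_umatrix a c b : urep_endo (umatrix a c b) = span_endo a c b.
Proof.
rewrite urep_endo_span; last exact: umatrix_in_u.
rewrite /span_endo; congr (_ + _ + _); apply: eq_bigr => j _.
- by apply: eq_bigr => k jk; rewrite mxE jk.
- by rewrite mxE ltnn.
- by apply: eq_bigr => k jk; rewrite mxE jk.
Qed.

Lemma urep_isomorphism : u_isomorphism (@real_span_ABC R n) urep.
Proof.
split.
- move=> t X Y _ _ _ /polyspinor_surj[v ->].
  by rewrite !represented_urep [urep_endo _]glrho_lin.
- move=> X Y _ _ _ /polyspinor_surj[v ->].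
  rewrite !represented_urep.
  by rewrite [urep_endo _](glrho_lie pair_z pair_zb pair_q
    indep_z_zb indep_z_q indep_zb_q).
- move=> X Y _ _ XY; apply: urep_endo_inj.
  exact: represented_inj (represented_urep X) (represented_urep Y) XY.
- move=> X uX; exists (fun j k => complex.Im (X j k)), (fun j k => complex.Re (X j k)),
    (fun j => complex.Im (X j j)).
  move=> _ /polyspinor_surj[v ->].
  by rewrite represented_urep urep_endo_span // -represented_span.
- move=> D [a [c [b DE]]]; exists (umatrix a c b); first exact: umatrix_in_u.
  move=> F TF; rewrite DE //; have [v ->] := polyspinor_surj TF.
  by rewrite represented_urep urep_endo_umatrix -represented_span.
Qed.

Lemma represented_invariant D e : represented D e -> invariant e ->
  [/\ is_endo D, commute_on (@Ds R n) D & commute_on (@Dt R n) D].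
Proof.
move=> De [es et]; split; first exact: represented_endo De.
- exact: represented_commute represented_Ds De es.
- exact: represented_commute represented_Dt De et.
Qed.

End Representation.

Theorem corollary3p8 (R : realType) (n : nat) (hn : (1 <= n)%N) :
  [/\ is_endo (@Ds R n) /\ is_endo (@Dt R n),
      forall j k : 'I_n, (j < k)%N ->
        [/\ is_endo (@opA R n j k),
            commute_on (@Ds R n) (opA j k) & commute_on (@Dt R n) (opA j k)],
      forall j : 'I_n,
        [/\ is_endo (@opB R n j),
            commute_on (@Ds R n) (opB j) & commute_on (@Dt R n) (opB j)],
      forall j k : 'I_n, (j < k)%N ->
        [/\ is_endo (@opC R n j k),
            commute_on (@Ds R n) (opC j k) & commute_on (@Dt R n) (opC j k)]
    & exists rho : 'M[R[i]]_n -> operator R n,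
        u_isomorphism (@real_span_ABC R n) rho /\
        (forall X, in_u X ->
           commute_on (@Ds R n) (rho X) /\ commute_on (@Dt R n) (rho X))].
Proof.
split.
- by split; [exact: represented_endo (@represented_Ds R n)
            |exact: represented_endo (@represented_Dt R n)].
- move=> j k _; apply: represented_invariant (represented_A j k) _.
  by apply/invariantZ/invariantD; exact: invariant_spinorE.
- move=> j; apply: represented_invariant (represented_B j) _.
  exact/invariantZ/invariant_spinorE.
- move=> j k _; apply: represented_invariant (represented_C j k) _.
  rewrite -scaleN1r; apply: invariantD; last apply: invariantZ;
    exact: invariant_spinorE.
exists (@urep R n); split=> [|X _]; first exact: urep_isomorphism.
have inv : invariant (urep_endo X).
  rewrite urep_endoE; do 2!(apply: invariant_sum => ?).
  exact/invariantZ/invariant_spinorE.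
by have [] := represented_invariant (represented_urep X) inv.
Qed.
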